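(* Let $A^{\{1,3\}}_{132}(z)=\sum_{n\ge0}a_n z^n$, where $a_n$ is the number of permutations $\pi\in\mathfrak{S}_n$ that avoid $132$ and all of whose cycles have length $1$ or $3$ (with $a_0=1$). Let $c(x)=\frac{1-\sqrt{1-4x}}{2x}$ be the generating function of the Catalan numbers, let \[m(t,x)=\dfrac{2}{1-2tx+x+\sqrt{1-2x-3x^2}},\] and let $F(t,x)=1+xt\,m(t,x)$. Then \[ A^{\{1,3\}}_{132}(z)=\frac{1}{1-z}\,F\!\left(\frac{2}{1-z},\,c(z^3)-1\right), \] and equivalently \[ A^{\{1,3\}}_{132}(z)=\dfrac{c(z^3)}{\sqrt{c(z^3)\,(4-3c(z^3))}-z\,c(z^3)}. \]
   Context: $\mathfrak{S}_n$ is the symmetric group on $[n]$, with permutations written in one-line notation $\pi_1\cdots\pi_n$. A permutation contains a pattern $\sigma$ if some subsequence of its one-line notation is in the same relative order as $\sigma$; otherwise it avoids $\sigma$. The function $m(t,x)$ is the bivariate generating function $\sum_{k,j}M_{k,j}x^kt^j$ where $M_{k,j}$ is the number of Motzkin paths of length $k$ with exactly $j$ flat steps at height zero. *)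

(* Defs.v *)
From mathcomp Require Import all_boot all_fingroup.
From Stdlib Require Import Reals.
Set Implicit Arguments. Unset Strict Implicit. Unset Printing Implicit Defensive.

Definition contains132 (n : nat) (s : {perm 'I_n}) : bool :=
  [exists i : 'I_n, exists j : 'I_n, exists k : 'I_n,
     [&& (i < j)%N, (j < k)%N, (s i < s k)%N & (s k < s j)%N]].

Definition avoids132 (n : nat) (s : {perm 'I_n}) : bool := ~~ contains132 s.

Definition cycles13 (n : nat) (s : {perm 'I_n}) : bool :=
  [forall x : 'I_n, (#|porbit s x| == 1)%N || (#|porbit s x| == 3)%N].

Definition a13 (n : nat) : nat :=
  #|[set s : {perm 'I_n} | avoids132 s && cycles13 s]|.

Open Scope R_scope.

(* Catalan generating function c(x) = (1 - sqrt(1-4x))/(2x), extended by its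
   value c(0) = 1 at the removable singularity x = 0. *)
Definition catC (x : R) : R :=
  if Req_EM_T x 0 then 1 else (1 - sqrt (1 - 4 * x)) / (2 * x).

Definition mtx (t x : R) : R :=
  2 / (1 - 2 * t * x + x + sqrt (1 - 2 * x - 3 * x ^ 2)).

Definition Ftx (t x : R) : R := 1 + x * t * mtx t x.

(* Main.v *)
(** Cycles have length 1 or 3 exactly when [t ^ 3 = 1].  Let [t] be such a
    132-avoider and let [m] be maximal such that [t] maps the positions below
    [m] to values at least [m].  Avoidance forces [t] to be increasing on the
    positions at least [m] with values at least [m]; hence every 3-cycle is of
    the form [i -> x -> z -> i] with [i < m <= x, z], and the increasing map
    sends the k-th [x] to the k-th [z].  So [t] is given by the word over
    {X, Z, F} recording the types of the positions [m, m+1, ...] (F being the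
    fixed points, which occur only where the numbers of X's and Z's read so far
    agree) and by the 132-avoiding permutation [s] of size [m] recording the
    ranks of the [t i].  Avoidance of 132 by [t] then says that the X's, and the
    Z's, whose ranks lie in one skew component of [s] are adjacent.

    Contracting components, the words become bridges with [r] X-steps and [r]
    Z-steps, [r] the number of components, with fixed points inserted at
    balanced places: these are counted by [1 / (sqrt (1 - 4 y) - z)], while the
    132-avoiders are counted by components by [y = w c(w)] per component, with
    [w = z ^ 3].  Writing [B] for [1 / sqrt (1 - 4 w c(w))] this gives
    [c = 1 + w c ^ 2], [B ^ 2 (1 - 4 w c) = 1] and [A = B + z B A], from which
    both closed forms follow for small [z]. *)

Require Import Defs.
From Stdlib Require Import Reals Lra.
From Coquelicot Require Import Coquelicot.
From mathcomp Require Import all_boot all_fingroup all_order all_algebra.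
From mathcomp Require Import cyclic zify.
Set Implicit Arguments. Unset Strict Implicit. Unset Printing Implicit Defensive.
Local Open Scope nat_scope.

(** * Words of blocks *)

(** Lattice paths from (p, q) to (i, i) when [i <= p]. Without the factor [i <= q], truncated
    subtraction would yield 1 at [p = i > q]. *)
Definition free_paths (p q i : nat) : nat :=
  (i <= q) * 'C(p + q - i.*2, p - i).

(* Lattice paths from (p, q) to the origin carrying f marks on the diagonal; the
   sum runs over the position (i, i) of the first mark. *)
Fixpoint bridges (f p q : nat) : nat :=
  if f is f'.+1 then \sum_(i < p.+1) free_paths p q i * bridges f' i i
  else 'C(p + q, p).

(** Pascal's rule applied to the first step of a path; the last term is the empty path. *)
Lemma free_paths_rec p q i : i <= p ->
  free_paths p q i =
    (i < p) * free_paths p.-1 q i + (0 < q) * free_paths p q.-1 i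
    + (p == q) * (i == p).
Proof.
rewrite /free_paths => lip; have [liq|lqi] := leqP i q; last first.
  by rewrite !mul0n !muln0 /= (_ : (i <= q.-1) = false) ?muln0 1?(_ : (p == q) && (i == p) = false); lia.
have [p' ->] : exists p', p = i + p' by exists (p - i); lia.
have [q' ->] : exists q', q = i + q' by exists (q - i); lia.
have -> : i + p' + (i + q') - i.*2 = p' + q' by lia.
have -> : i + p' - i = p' by lia.
case: p' => [|p']; case: q' => [|q'].
- by rewrite !bin0 !addn0 ltnn !eqxx /=; case: i {lip liq} => //= i; rewrite ltnn.
- rewrite !bin0 !addn0 ltnn !eqxx /= addnS /= leq_addr.
  by rewrite (_ : (i == (i + q').+1) = false); lia.
- rewrite !addn0 addnS /= ltnS leq_addr.
  have -> : i + p' + i - i.*2 = p' by lia.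
  have -> : i + p' - i = p' by lia.
  rewrite !binn (_ : ((i + p').+1 == i) = false); last by lia.
  by case: i {lip liq} => //= i; rewrite ltnn.
- have -> : (i < i + p'.+1) = true by lia.
  have -> : (0 < i + q'.+1) = true by lia.
  have -> : (i <= (i + q'.+1).-1) = true by lia.
  have -> : (i == i + p'.+1) = false by lia.
  have -> : (i + p'.+1).-1 + (i + q'.+1) - i.*2 = (p' + q').+1 by lia.
  have -> : i + p'.+1 + (i + q'.+1).-1 - i.*2 = (p' + q').+1 by lia.
  have -> : (i + p'.+1).-1 - i = p' by lia.
  by rewrite muln0 !mul1n addn0 addSn addnS binS addnC.
Qed.

(** A marked path starts with an X-step, a Z-step or, on the diagonal, a mark; these are the choices
    for the next letter in [block_word]. When no mark is left, the third term is the empty path. *)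
Lemma bridges_rec f p q :
  bridges f p q =
    (0 < p) * bridges f p.-1 q + (0 < q) * bridges f p q.-1
    + (p == q) * (if f is f'.+1 then bridges f' p p else p == 0).
Proof.
case: f => [|f] /=.
  case: p q => [|p] [|q] //=; rewrite ?bin0 ?addn0 ?binn ?muln0 //.
  by rewrite addSn binS addSnnS !mul1n addn0 addnC.
transitivity (\sum_(i < p.+1) ((i < p) * free_paths p.-1 q i * bridges f i i
     + (0 < q) * (free_paths p q.-1 i * bridges f i i)
     + (p == q) * (i == p :> nat) * bridges f i i)).
  apply: eq_bigr => i _; rewrite free_paths_rec; last by rewrite -ltnS.
  by rewrite !mulnDl !mulnA.
rewrite !big_split /= -big_distrr /=; congr (_ + _ + _).
- rewrite big_ord_recr /= ltnn !mul0n addn0.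
  case: p => [|p]; first by rewrite big_ord0.
  rewrite mul1n /=; apply: eq_bigr => i _; by rewrite ltn_ord mul1n.
- rewrite big_ord_recr /= eqxx muln1 big1 ?add0n // => i _.
  by rewrite (ltn_eqF (ltn_ord i)) muln0.
Qed.

Lemma bridgesS f r :
  bridges f.+1 r r =
  \sum_(i < r.+1) 'C((r - i).*2, r - i) * bridges f i i.
Proof.
apply: eq_bigr => i _; rewrite /free_paths -ltnS ltn_ord mul1n.
by congr ('C(_, _) * _); lia.
Qed.

Section Words.
Variables (cut : pred nat) (m : nat).
(* [Some true], [Some false] and [None] are the letters X, Z and F; [a] and [b]
   are the numbers of X's and Z's already read, and the next letter is forced at
   an uncut rank. *)
Fixpoint block_word (a b : nat) (u : seq (option bool)) : bool :=
  if u is x :: u' then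
    [&& cut a || (x == Some true), cut b || (x == Some false) &
        match x with
        | Some true => (a < m) && block_word a.+1 b u'
        | Some false => (b < m) && block_word a b.+1 u'
        | None => (a == b) && block_word a b u'
        end]
  else (a == m) && (b == m).

Fixpoint words (l : nat) : seq (seq (option bool)) :=
  if l is l'.+1 then
    [seq x :: w | x <- [:: Some true; Some false; None], w <- words l']
  else [:: [::]].

Lemma mem_words l u : (u \in words l) = (size u == l).
Proof.
elim: l u => [|l IH] u; first by rewrite inE size_eq0.
apply/allpairsPdep/idP => [[y [w [_ wl ->]]]|]; first by rewrite eqSS -IH.
case: u => // x u; rewrite eqSS -IH => ul.
by exists x, u; split=> //; case: x => [[]|].
Qed.

Lemma words_uniq l : uniq (words l).
Proof.
elim: l => // l IH; apply: allpairs_uniq => //.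
by move=> [? ?] [? ?] _ _ [-> ->].
Qed.

Lemma block_word_size a b u :
  block_word a b u -> (m - a) + (m - b) <= size u.
Proof.
elim: u a b => [|x u IH] a b /=; first by lia.
by case/and3P=> _ _; case: x => [[]|] /andP[h /IH]; lia.
Qed.

(** The tests against [m] in the recursion follow from the final counts, which leaves one condition
    per prefix. Encoding and decoding both work with this form, since prefix counts compare ranks
    with positions. *)
Lemma block_wordP a b u : a <= m -> b <= m ->
  reflect
    [/\ a + count_mem (Some true) u = m, b + count_mem (Some false) u = m &
      forall p, p < size u ->
      let a' := a + count_mem (Some true) (take p u) in
      let b' := b + count_mem (Some false) (take p u) in
      let x := nth None u p in
      [/\ cut a' || (x == Some true), cut b' || (x == Some false)
        & x = None -> a' = b']]
    (block_word a b u).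
Proof.
elim: u a b => [|x u IH] a b lam lbm /=.
  by rewrite !addn0; apply: (iffP andP) => [[/eqP-> /eqP->]|[-> -> _]].
apply: (iffP idP).
  case/and3P=> cx cz h.
  have {h} [a' [b' [ea eb hx hu]]] : exists a' b',
    [/\ a' = a + (x == Some true), b' = b + (x == Some false),
        x = None -> a = b & a' <= m /\ b' <= m /\ block_word a' b' u].
    case: x h cx cz => [[]|] /andP[h1 h2] _ _.
    - by exists a.+1, b; rewrite addn1 addn0.
    - by exists a, b.+1; rewrite addn1 addn0.
    - by exists a, b; split; rewrite ?addn0 // => _; apply/eqP.
  case: hu => la [lb /(IH _ _ la lb) [eX eZ hp]].
  split; [by rewrite addnA -ea | by rewrite addnA -eb |].
  case=> [|p] /= lp; first by rewrite !addn0.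
  by have := hp p lp; rewrite ea eb /= -!addnA.
case=> eX eZ hp; have := hp 0 isT; rewrite /= !addn0 => -[-> -> hx] /=.
have hp' a' b' : a' = a + (x == Some true) -> b' = b + (x == Some false) ->
   a' <= m -> b' <= m -> block_word a' b' u.
  move=> ea eb la lb; apply/IH => //; split; [by rewrite ea -addnA | by rewrite eb -addnA |] => p lp.
  by have := hp p.+1 lp; rewrite ea eb /= -!addnA.
have lX : a + (x == Some true) <= m by rewrite -eX addnA leq_addr.
have lZ : b + (x == Some false) <= m by rewrite -eZ addnA leq_addr.
case: x hx hp' lX lZ {eX eZ hp} => [[]|]; rewrite ?addn1 ?addn0 => hx hp' lX lZ.
- by rewrite lX hp'.
- by rewrite lZ hp'.
- by rewrite hx // eqxx hp' // -hx.
Qed.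

Hypothesis cut_m : cut m.

Definition cuts_after (a : nat) : nat := count cut (iota a.+1 (m - a)).

Lemma cuts_after_rec a : a < m ->
  cuts_after a = cut a.+1 + cuts_after a.+1.
Proof. by move=> lam; rewrite /cuts_after (_ : m - a = (m - a.+1).+1) //; lia. Qed.

Lemma cuts_after_gt0 a : (0 < cuts_after a) = (a < m).
Proof.
rewrite -has_count; have [lam|lma] := ltnP a m.
  by apply/hasP; exists m => //; rewrite mem_iota; lia.
by rewrite (_ : m - a = 0) //; lia.
Qed.

Lemma cuts_after_lt a b : a < b <= m -> cut b ->
  cuts_after b < cuts_after a.
Proof.
move=> /andP[lab lbm] cb; rewrite /cuts_after.
have -> : m - a = (b - a.+1) + (m - b).+1 by lia.
rewrite iotaD count_cat /= (_ : a.+1 + (b - a.+1) = b) ?cb; lia.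
Qed.

Lemma cuts_after_eq a b : a <= m -> b <= m -> cut a -> cut b ->
  (cuts_after a == cuts_after b) = (a == b).
Proof.
move=> lam lbm ca cb; case: (ltngtP a b) => [h|h|->]; last by rewrite eqxx.
- by have := @cuts_after_lt a b; rewrite h lbm => /(_ isT cb); lia.
- by have := @cuts_after_lt b a; rewrite h lam => /(_ isT ca); lia.
Qed.

(** Each component is contracted to a single step. At an uncut rank the current component has been
    entered and its step already taken, hence the corrections [~~ cut]. The hypothesis
    [cut a || cut b] excludes the states in which no letter is allowed. *)
Lemma count_block_word f a b : a <= m -> b <= m -> cut a || cut b ->
  count (block_word a b) (words ((m - a) + (m - b) + f)) =
  bridges f (cuts_after a - ~~ cut a) (cuts_after b - ~~ cut b).
Proof.
have [l] := ubnP ((m - a) + (m - b) + f).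
elim: l f a b => // l IH f a b ltl lam lbm cab.
(* Past an X the contracted coordinate is the same whether or not this X finishes its component. *)
have afterX a' : a' < m -> cuts_after a'.+1 - ~~ cut a'.+1 = (cuts_after a').-1.
  by move=> h; rewrite (cuts_after_rec h); case: (cut _) => /=; lia.
have stepX : a < m -> cut b ->
    count (block_word a.+1 b) (words ((m - a) + (m - b) + f).-1) =
    bridges f (cuts_after a).-1 (cuts_after b).
  move=> h cb; rewrite -afterX //.
  have -> : ((m - a) + (m - b) + f).-1 = (m - a.+1) + (m - b) + f by lia.
  rewrite IH ?cb ?orbT ?subn0 //; lia.
have stepZ : b < m -> cut a ->
    count (block_word a b.+1) (words ((m - a) + (m - b) + f).-1) =
    bridges f (cuts_after a) (cuts_after b).-1.
  move=> h ca; rewrite -(afterX b) //.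
  have -> : ((m - a) + (m - b) + f).-1 = (m - a) + (m - b.+1) + f by lia.
  rewrite IH ?ca ?orbT ?subn0 //; lia.
case E: ((m - a) + (m - b) + f) stepX stepZ => [|k] stepX stepZ.
  have -> : a = m by lia.
  have -> : b = m by lia.
  have -> : f = 0 by lia.
  by rewrite /= eqxx /cuts_after subnn.
rewrite /= cats0 !count_cat !count_map.
have lt_cut x : x <= m -> ~~ cut x -> x < m.
  by rewrite leq_eqVlt => /orP[/eqP->|//]; rewrite cut_m.
have cE x P : (forall u, block_word a b (x :: u) = P u) ->
    count (preim [eta cons x] (block_word a b)) (words k) = count P (words k).
  by move=> h; apply: eq_count.
(* At two cuts all letters are possible and [bridges_rec] applies; at exactly one cut the letter is
   forced and continues a step that is already counted. *)
case ca: (cut a); case cb: (cut b); last by rewrite ca cb in cab.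
- rewrite !subn0 bridges_rec !cuts_after_gt0 addnA; congr (_ + _ + _).
  + rewrite (eq_count (a2 := fun u => (a < m) && block_word a.+1 b u)); last first.
      by move=> u /=; rewrite ca cb.
    by case: ltnP => h; rewrite /= ?count_pred0 // mul1n stepX.
  + rewrite (eq_count (a2 := fun u => (b < m) && block_word a b.+1 u)); last first.
      by move=> u /=; rewrite ca cb.
    by case: ltnP => h; rewrite /= ?count_pred0 // mul1n stepZ.
  + rewrite (eq_count (a2 := fun u => (a == b) && block_word a b u)); last first.
      by move=> u /=; rewrite ca cb.
    rewrite cuts_after_eq //; case: eqP => [eab|_] /=; last by rewrite count_pred0.
    (* With [f = 0], reading an F would leave one letter too few for the remaining X's and Z's. *)
    rewrite mul1n -eab; case: f ltl E {stepX stepZ} => [|f] ltl E.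
      rewrite (_ : (_ == 0) = false); last first.
        by apply/negbTE; rewrite -lt0n cuts_after_gt0; lia.
      apply/eqP; rewrite -leqn0 leqNgt -has_count; apply/hasPn => u.
      by rewrite mem_words => /eqP szu; apply/negP => /block_word_size; rewrite szu; lia.
    have -> : k = (m - a) + (m - a) + f by lia.
    by rewrite IH ?ca ?subn0 //; lia.
- rewrite (cE _ pred0); last by move=> u /=; rewrite cb andbF.
  rewrite (cE _ (block_word a b.+1)); last by move=> u /=; rewrite ca cb lt_cut ?cb.
  rewrite (cE _ pred0); last by move=> u /=; rewrite cb andbF.
  by rewrite count_pred0 add0n addn0 stepZ ?lt_cut ?cb // subn0 subn1.
- rewrite (cE _ (block_word a.+1 b)); last by move=> u /=; rewrite ca cb lt_cut ?ca.
  rewrite (cE _ pred0); last by move=> u /=; rewrite ca.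
  rewrite (cE _ pred0); last by move=> u /=; rewrite ca.
  by rewrite count_pred0 !addn0 stepX ?lt_cut ?ca // subn0 subn1.
Qed.

End Words.

(** * 132-avoiding permutations and their skew components *)

Fixpoint av132 (s : seq nat) : bool :=
  if s is x :: s' then
    pairwise (fun y z => ~~ (x < z < y)) s' && av132 s'
  else true.

(* No non-inversion separates the values below [v] from the others, i.e. a skew
   component ends at [v]. *)
Definition skew_cut (s : seq nat) (v : nat) : bool :=
  pairwise (fun x y => ~~ (x < v <= y)) s.

Definition skew_blocks (s : seq nat) : nat := count (skew_cut s) (iota 1 (size s)).

Definition av132_perms (m : nat) : seq (seq nat) :=
  [seq s <- permutations (iota 0 m) | av132 s].

Definition catalan (m : nat) : nat := size (av132_perms m).

Lemma mem_av132_perms m s :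
  (s \in av132_perms m) = av132 s && perm_eq s (iota 0 m).
Proof. by rewrite mem_filter mem_permutations. Qed.

Lemma av132_perms_uniq m : uniq (av132_perms m).
Proof. exact/filter_uniq/permutations_uniq. Qed.

Lemma av132P s :
  reflect (forall i j k, i < j -> j < k -> k < size s ->
             ~~ (nth 0 s i < nth 0 s k < nth 0 s j))
          (av132 s).
Proof.
elim: s => [|x s IH] /=; first by apply: ReflectT => i j k _ _; rewrite ltn0.
apply: (iffP andP) => [[/(pairwiseP 0) px /IH ps] [|i] [|j] [|k] //|h].
- by move=> _ ljk lk; apply: px; rewrite ?inE //=; lia.
- by move=> lij ljk lk; apply: (ps i j k).
split; last by apply/IH => i j k lij ljk lk; apply: (h i.+1 j.+1 k.+1).
by apply/(pairwiseP 0) => j k _ lk ljk; apply: (h 0 j.+1 k.+1).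
Qed.

Lemma skew_cutPn s v :
  reflect (exists i j, [/\ i < j, j < size s & nth 0 s i < v <= nth 0 s j])
          (~~ skew_cut s v).
Proof.
apply: (iffP idP) => [|[i [j [lij lj h]]]]; last first.
  apply/negP => /(pairwiseP 0) /(_ i j); rewrite !inE h => /(_ _ lj lij).
  by move=> hn; have := hn (ltn_trans lij lj).
move=> hn; have [|hno] := boolP [exists i : 'I_(size s), exists j : 'I_(size s),
    (i < j) && (nth 0 s i < v <= nth 0 s j)].
  by case/existsP=> i /existsP[j /andP[lij h]]; exists i, j.
case/negP: hn; apply/(pairwiseP 0) => i j; rewrite !inE => li lj lij.
apply/negP => h; case/negP: hno; apply/existsP; exists (Ordinal li).
by apply/existsP; exists (Ordinal lj); rewrite lij.
Qed.

Lemma pairwise_in (s : seq nat) (r : rel nat) :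
  {in s &, forall x y, r x y} -> pairwise r s.
Proof.
by move=> h; apply/(pairwiseP 0) => i j li lj _; apply: h; apply: mem_nth.
Qed.

Lemma perm_iota_lt m s x : perm_eq s (iota 0 m) -> x \in s -> x < m.
Proof. by move=> /perm_mem->; rewrite mem_iota. Qed.

Lemma skew_cut_size m s : perm_eq s (iota 0 m) -> skew_cut s m.
Proof.
move=> sm; apply/negPn/negP => /skew_cutPn [i [j [_ lj h]]].
case/andP: h => _; rewrite leqNgt => /negP; apply.
exact: perm_iota_lt sm (mem_nth 0 lj).
Qed.

Lemma skew_cut0 s : skew_cut s 0.
Proof. by apply/negPn/negP => /skew_cutPn [i [j [_ _]]]. Qed.

(** A 132-avoider split at its maximum [m]: the entries to its left all exceed the [q] entries to
    its right. *)
Definition skew_join (m q : nat) (l r : seq nat) : seq nat :=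
  map (addn q) l ++ m :: r.

Lemma av132_map_addn q l : av132 (map (addn q) l) = av132 l.
Proof.
elim: l => //= x l ->; congr (_ && _); rewrite pairwise_map.
by apply: eq_pairwise => y z /=; rewrite !ltn_add2l.
Qed.

(** A 132 has its last entry above its first, so it cannot start in [l] or at [m] and end in [r],
    whose values are lower; nor can it end at the maximum. *)
Lemma av132_cat_max m q l r :
  {in l, forall x, q <= x < m} -> {in r, forall x, x < q} -> q <= m ->
  av132 (l ++ m :: r) = av132 l && av132 r.
Proof.
move=> hl hr lqm; elim: l hl => [|x l IH] hl /=.
  rewrite (_ : pairwise _ r) //; apply: pairwise_in => x y _ /hr.
  by lia.
rewrite IH => [|y yl]; last by apply: hl; rewrite inE yl orbT.
rewrite pairwise_cat.
have hx : q <= x < m by apply: hl; rewrite mem_head.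
rewrite (_ : pairwise _ (m :: r)) ?andbT.
  rewrite (_ : allrel _ _ _) ?andbA //; apply/allrelP => y z yl.
  have := hl y; rewrite inE yl orbT => /(_ isT).
  by rewrite inE => hy /orP[/eqP->|/hr]; lia.
rewrite /=; apply/andP; split.
  by apply/allP => z /hr; lia.
by apply: pairwise_in => y z _ /hr; lia.
Qed.

Lemma skew_join_perm m q l r : q <= m ->
  perm_eq l (iota 0 (m - q)) -> perm_eq r (iota 0 q) ->
  perm_eq (skew_join m q l r) (iota 0 m.+1).
Proof.
move=> lqm hl hr; rewrite /skew_join -cat1s perm_catCA.
rewrite -[m.+1]addn1 iotaD perm_sym perm_catC /= perm_cons perm_sym.
rewrite perm_sym -[in iota 0 m](subnKC lqm) iotaD perm_catC perm_sym; apply: perm_cat => //.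
by rewrite addnC iotaDl; apply: perm_map.
Qed.

(** The shifted [l] and the maximum form one component: the value [q] precedes [m], and this
    non-inversion crosses every [v] with [q < v <= m]. Cuts up to [q] are those of [r], and [m.+1]
    is the only new one. *)
Lemma skew_blocks_join m q l r : q <= m ->
  perm_eq l (iota 0 (m - q)) -> perm_eq r (iota 0 q) ->
  skew_blocks (skew_join m q l r) = (skew_blocks r).+1.
Proof.
move=> lqm hl hr; rewrite /skew_blocks.
have szr : size r = q by rewrite (perm_size hr) size_iota.
have szl : size l = m - q by rewrite (perm_size hl) size_iota.
have -> : size (skew_join m q l r) = q + ((m - q) + 1).
  by rewrite size_cat size_map /= szr szl; lia.
rewrite iotaD iotaD !count_cat szr.
have hl' x : x \in map (addn q) l -> q <= x < m.
  by case/mapP=> y /(perm_iota_lt hl) ? ->; lia.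
have hr' x : x \in r -> x < q by exact: perm_iota_lt hr.
rewrite (_ : count _ (iota (1 + q) _) = 0); last first.
  apply/eqP; rewrite -leqn0 leqNgt -has_count; apply/hasPn => v.
  rewrite mem_iota => hv; rewrite /skew_cut /skew_join pairwise_cat.
  suff: ~~ allrel (fun x y => ~~ (x < v <= y)) (map (addn q) l) (m :: r).
    by move/negbTE->.
  apply/allrelP => /(_ q m); rewrite mem_head => h.
  have : ~~ (q < v <= m) by apply: h => //; apply/mapP; exists 0;
    rewrite ?addn0 // (perm_mem hl) mem_iota; lia.
  by lia.
have -> : count (skew_cut (skew_join m q l r)) (iota (1 + q + (m - q)) 1) = 1.
  rewrite /= (_ : _ + (m - q) = m.+1) ?(skew_cut_size (m := m.+1)) //; last lia.
  exact: skew_join_perm.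
rewrite add0n addn1; congr _.+1; apply: eq_in_count => v.
rewrite mem_iota => hv; rewrite /skew_cut /skew_join pairwise_cat /=.
rewrite (_ : allrel _ _ _); last first.
  by apply/allrelP => x y /hl'; lia.
rewrite (_ : pairwise _ (map _ _)); last first.
  by apply: pairwise_in => x y /hl'; lia.
rewrite (_ : all _ _) //; by apply/allP => x; lia.
Qed.

(** For [x] to the left and [y] to the right of the maximum [m], having [x < y] would make [x m y] a
    132. So the values on the right are closed downwards, hence are exactly those below [size r]. *)
Lemma skew_join_split m s : perm_eq s (iota 0 m.+1) -> av132 s ->
  exists q l r, [/\ q <= m, perm_eq l (iota 0 (m - q)), perm_eq r (iota 0 q),
                    s = skew_join m q l r & av132 l && av132 r].
Proof.
move=> hs avs; have us : uniq s by rewrite (perm_uniq hs) iota_uniq.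
have ms : m \in s by rewrite (perm_mem hs) mem_iota /=.
case/splitPr: ms hs avs us => l r hs avs us.
have lr (x y : nat) : x \in l -> y \in r -> y < x.
  move=> xl yr; case/splitPr: xl hs avs us => l1 l2; rewrite -catA cat_cons.
  move=> hs avs us.
  have ym : y < m.
    have : y < m.+1 by apply: perm_iota_lt hs _; rewrite !(mem_cat, inE) yr !orbT.
    rewrite ltnS leq_eqVlt => /orP[/eqP eym|//].
    move: us; rewrite cat_uniq /= cat_uniq /=.
    by rewrite -eym yr !andbF.
  have nxy : x != y.
    by apply/eqP => exy; move: us; rewrite cat_uniq cons_uniq mem_cat inE exy yr !orbT /= !andbF.
  have /andP[px _] : av132 (x :: l2 ++ m :: r).
    by elim: l1 avs {hs us} => //= z l1 IH /andP[_ /IH].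
  move: px; rewrite pairwise_cat /= => /and4P[_ _ /allP /(_ y yr)].
  by lia.
have [ul ur] : uniq l /\ uniq r.
  by move: us; rewrite cat_uniq /= => /and3P[-> _ /andP[_ ->]].
have mr : m \notin r by move: us; rewrite cat_uniq /= => /and3P[_ _ /andP[->]].
have ml : m \notin l.
  by move: us; rewrite cat_uniq /= => /and3P[_ h _]; case/norP: h.
pose q := size r.
have memlr (x : nat) : x < m -> (x \in l) || (x \in r).
  move=> h; have := perm_mem hs x; rewrite mem_cat inE mem_iota /= add0n.
  by rewrite (ltn_eqF h) /= => ->; lia.
have rq (y : nat) : y \in r -> y < q.
  move=> yr; have: {subset iota 0 y.+1 <= r}.
    move=> x; rewrite mem_iota /= add0n ltnS => lxy.
    have ym : y < m.
      have : y < m.+1 by apply: perm_iota_lt hs _; rewrite !(mem_cat, inE) yr !orbT.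
      by rewrite ltnS leq_eqVlt => /orP[/eqP eym|//]; rewrite -eym yr in mr.
    have /orP[xl|//] := memlr x (leq_ltn_trans lxy ym).
    by have := lr _ _ xl yr; lia.
  by move/(uniq_leq_size (iota_uniq _ _)); rewrite size_iota.
have hr : perm_eq r (iota 0 q).
  apply: uniq_perm; rewrite ?iota_uniq //.
  apply: (uniq_min_size ur _ _).2; last by rewrite size_iota.
  by move=> y /rq; rewrite mem_iota.
have szl : q + size l = m.
  by have := perm_size hs; rewrite size_cat /= size_iota -/q; lia.
have lq (x : nat) : x \in l -> q <= x.
  move=> xl; rewrite leqNgt; apply/negP => h.
  have xr : x \in r by rewrite (perm_mem hr) mem_iota.
  by have := lr _ _ xl xr; rewrite ltnn.
have lm (x : nat) : x \in l -> x < m.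
  move=> xl; have : x < m.+1 by apply: perm_iota_lt hs _; rewrite mem_cat xl.
  by rewrite ltnS leq_eqVlt => /orP[/eqP exm|//]; rewrite -exm xl in ml.
have el : l = map (addn q) (map (subn^~ q) l).
  rewrite -map_comp -[LHS]map_id; apply/eq_in_map => x /lq /=; lia.
exists q, (map (subn^~ q) l), r; split => //; first by lia.
- apply: uniq_perm; rewrite ?iota_uniq //.
    by rewrite map_inj_in_uniq // => x y /lq hx /lq hy; lia.
  apply: (uniq_min_size _ _ _).2.
  + by rewrite map_inj_in_uniq // => x y /lq hx /lq hy; lia.
  + by move=> _ /mapP[x xl ->]; rewrite mem_iota; have := lq _ xl; have := lm _ xl; lia.
  + by rewrite size_iota size_map -szl addKn.
- by rewrite /skew_join -el.
- move: avs; rewrite (@av132_cat_max m q); [|by move=> x xl; rewrite lq ?lm|exact: rq|lia].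
  by rewrite {1}el av132_map_addn.
Qed.

Lemma av132_permsS m :
  perm_eq (av132_perms m.+1)
    [seq skew_join m q x.1 x.2 | q <- iota 0 m.+1,
       x <- [seq (l, r) | l <- av132_perms (m - q), r <- av132_perms q]].
Proof.
apply: uniq_perm; first exact: av132_perms_uniq.
  apply: allpairs_uniq_dep; first exact: iota_uniq.
    move=> q _; apply: allpairs_uniq; rewrite ?av132_perms_uniq //.
    by move=> [? ?] [? ?] _ _ [-> ->].
  move=> t1 t2 /allpairsPdep[q [x [hq hx ->]]] /allpairsPdep[q' [x' [hq' hx' ->]]] /=.
  move: hx hx'; case/allpairsP=> -[l r] /= [hl hr ->].
  case/allpairsP=> -[l' r'] /= [hl' hr' ->] /=.
  move: hl hr hl' hr'; rewrite !mem_av132_perms.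
  move=> /andP[_ hl] /andP[_ hr] /andP[_ hl'] /andP[_ hr'].
  have mnl k z : perm_eq z (iota 0 (m - k)) -> k <= m -> m \notin map (addn k) z.
    move=> hz lk; apply/mapP => -[w /(perm_iota_lt hz)]; lia.
  rewrite !mem_iota in hq hq'; rewrite /skew_join => e.
  (* The position of the maximum gives the size of the left part, hence [q]. *)
  have szE : size (map (addn q) l) = size (map (addn q') l').
    have := congr1 (index m) e; rewrite !index_cat.
    by rewrite (negbTE (mnl _ _ hl _)) 1?(negbTE (mnl _ _ hl' _)) ?index_head //=; lia.
  have eq : q = q'.
    by move: szE; rewrite !size_map (perm_size hl) (perm_size hl') !size_iota; lia.
  subst q'; move/eqP: e; rewrite eqseq_cat // eqseq_cons => /and3P[/eqP e1 _ /eqP ->].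
  by rewrite (inj_map (@addnI q) e1).
move=> s; rewrite mem_av132_perms; apply/andP/allpairsPdep.
  case=> avs hs; have [q [l [r [lqm hl hr -> /andP[al ar]]]]] := skew_join_split hs avs.
  exists q, (l, r); split=> //; first by rewrite mem_iota.
  by apply/allpairsP; exists (l, r); rewrite !mem_av132_perms al ar.
case=> q [x [hq /allpairsP[[l r] /= [hl hr ->]] -> /=]].
move: hl hr hq; rewrite !mem_av132_perms mem_iota ltnS => /andP[al hl] /andP[ar hr] /= lqm.
split; last exact: skew_join_perm.
rewrite (@av132_cat_max m q) ?av132_map_addn ?al //.
- by move=> _ /mapP[y /(perm_iota_lt hl) ? ->]; lia.
- by move=> w /(perm_iota_lt hr).
Qed.

(** The weight [h] stays arbitrary because removing a component shifts it. Constant 1 gives the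
    Catalan numbers, bridge counts give the codes. *)
Definition skew_sum (m : nat) (h : nat -> nat) : nat :=
  \sum_(s <- av132_perms m) h (skew_blocks s).

Lemma skew_sum0 h : skew_sum 0 h = h 0.
Proof. by rewrite /skew_sum (_ : av132_perms 0 = [:: [::]]) // big_seq1. Qed.

(** Splitting at the maximum removes one component, made of the maximum and an arbitrary avoider;
    this is the factor [w c(w)] per component. *)
Lemma skew_sumS m h :
  skew_sum m.+1 h =
  \sum_(q < m.+1) catalan (m - q) * skew_sum q (fun r => h r.+1).
Proof.
rewrite /skew_sum (perm_big _ (av132_permsS m)) big_allpairs_dep.
rewrite -(big_mkord xpredT (fun q => catalan (m - q) *
  \sum_(s <- av132_perms q) h (skew_blocks s).+1)) /index_iota subn0.
rewrite !big_seq; apply: eq_bigr => q; rewrite mem_iota /= => lqm.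
rewrite big_allpairs /= /catalan -sum1_size big_distrl /= !big_seq.
apply: eq_bigr => l; rewrite mem_av132_perms => /andP[_ hl].
rewrite mul1n !big_seq; apply: eq_bigr => r; rewrite mem_av132_perms => /andP[_ hr].
by rewrite skew_blocks_join.
Qed.

Lemma catalanE m : catalan m = skew_sum m (fun=> 1).
Proof. by rewrite /skew_sum sum1_size. Qed.

(** * Encoding by a permutation and a word *)

(** Letter [k] of the word describes position [m + k], so positions and values of the permutation
    can be compared directly. *)
Definition positions (m : nat) (u : seq (option bool)) (x : option bool) : seq nat :=
  [seq p <- iota m (size u) | nth None u (p - m) == x].

Section Positions.
Variables (m : nat) (u : seq (option bool)) (x : option bool).
Local Notation ps := (positions m u x).

Lemma positions_sorted : sorted ltn ps.
Proof. exact/sorted_filter/iota_ltn_sorted/ltn_trans. Qed.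

Lemma positions_uniq : uniq ps.
Proof. exact/filter_uniq/iota_uniq. Qed.

Lemma mem_positions p :
  (p \in ps) = (m <= p < m + size u) && (nth None u (p - m) == x).
Proof. by rewrite mem_filter mem_iota andbC. Qed.

Lemma count_positions k : k <= size u ->
  count (fun p => nth None u (p - m) == x) (iota m k) = count_mem x (take k u).
Proof.
move=> lk; have -> : take k u = [seq nth None u (p - m) | p <- iota m k].
  apply: (@eq_from_nth _ None); first by rewrite size_map size_iota size_takel.
  move=> i; rewrite size_takel // => li.
  by rewrite (nth_map 0) ?size_iota // nth_iota // addKn nth_take.
by rewrite count_map.
Qed.

Lemma size_positions : size ps = count_mem x u.
Proof. by rewrite size_filter count_positions // take_size. Qed.

(** The dictionary between prefix counts of the word and the order of positions: occurrence [a]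
    comes before [p] exactly when more than [a] occurrences precede [p]. *)
Lemma nth_positions_lt a p : a < count_mem x u -> m <= p <= m + size u ->
  (nth 0 ps a < p) = (a < count_mem x (take (p - m) u)).
Proof.
move=> la hp; rewrite -count_positions; last by lia.
rewrite -size_filter; move: la; rewrite -size_positions.
have -> : ps = [seq q <- iota m (p - m) | nth None u (q - m) == x] ++
               [seq q <- iota p (m + size u - p) | nth None u (q - m) == x].
  rewrite -filter_cat /positions (_ : size u = (p - m) + (m + size u - p)); last lia.
  by rewrite iotaD; congr (filter _ (_ ++ iota _ _)); lia.
set A := filter _ (iota m _); set B := filter _ _; rewrite size_cat nth_cat => la.
case: (ltnP a (size A)) => h.
  have := mem_nth 0 h; rewrite mem_filter mem_iota => /andP[_ /andP[_]].
  by rewrite subnKC //; case/andP: hp.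
have /(mem_nth 0) : a - size A < size B by lia.
by rewrite mem_filter mem_iota => /andP[_ /andP[h' _]]; apply/negbTE; rewrite -leqNgt.
Qed.

Lemma nth_positions_ltn a b : a < count_mem x u -> b < count_mem x u ->
  (nth 0 ps a < nth 0 ps b) = (a < b).
Proof.
rewrite -!size_positions => la lb.
have mono i j : i < size ps -> j < size ps -> i < j -> nth 0 ps i < nth 0 ps j.
  by move=> li lj; apply: (sorted_ltn_nth ltn_trans 0 positions_sorted).
case: (ltngtP a b) => [h|h|->]; last by rewrite ltnn.
  exact: mono.
by apply/negbTE; rewrite -leqNgt ltnW ?mono.
Qed.

End Positions.

(** * The threshold of a 132-avoider whose cube is the identity *)

Record cubic_av132 (n : nat) (t : nat -> nat) : Prop := CubicAv132 {
  cav_lt : forall i, i < n -> t i < n;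
  cav_cube : forall i, i < n -> t (t (t i)) = i;
  cav_av : forall i j k, i < j -> j < k -> k < n -> ~~ (t i < t k < t j) }.

Lemma cav_inj n t i j : cubic_av132 n t -> i < n -> j < n -> t i = t j -> i = j.
Proof. by move=> ht li lj e; rewrite -(cav_cube ht li) -(cav_cube ht lj) e. Qed.

(** In place of the maximality of [m] stands the increasing property that it implies; for a cubic
    132-avoider this already determines [m], by [cycle_minima_thr]. *)
Record threshold (n : nat) (t : nat -> nat) (m : nat) : Prop := Threshold {
  thr_le : m <= n;
  thr_small : forall i, i < m -> m <= t i;
  thr_incr : forall p q, m <= p -> p < q -> q < n -> m <= t p -> m <= t q ->
    t p < t q }.

(* The largest m with t i >= m for all i < m works: some i <= m has t i <= m,
   and it would play the role of 1 in a pattern 132. *)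
Lemma threshold_ex n t : cubic_av132 n t -> exists m, threshold n t m.
Proof.
move=> ht; pose P m := (m <= n) && all (fun i => m <= t i) (iota 0 m).
have exP : exists m, P m by exists 0.
have ubP m : P m -> m <= n by case/andP.
case: (ex_maxnP exP ubP) => m /andP[lmn /allP hm] hmax.
exists m; split => // [i lim|p q lmp lpq lqn lmtp lmtq].
  by apply: hm; rewrite mem_iota.
have lmn' : m < n by lia.
have [i lim tim] : exists2 i, i <= m & t i <= m.
  have : ~~ P m.+1 by apply/negP => /hmax; rewrite ltnn.
  rewrite /P lmn' -has_predC => /hasP[i]; rewrite mem_iota /= => h1 h2.
  by exists i; lia.
rewrite ltnNge; apply/negP => htqp.
have ntqp : t q <> t p by move=> /(cav_inj ht lqn (ltn_trans lpq lqn)) e; lia.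
have lin : i < n by lia.
have ntiq : t i <> t q by move=> /(cav_inj ht lin lqn) e; lia.
have [h|h] := ltnP i p; last first.
  by have e : i = p by [lia]; rewrite e in tim; lia.
by have := cav_av ht h lpq lqn; lia.
Qed.

(** An intrinsic value of the threshold, which makes [encode] a function of [t] without any
    choice. *)
Definition cycle_minima (n : nat) (t : nat -> nat) : nat :=
  count (fun i => (i < t i) && (i < t (t i))) (iota 0 n).

(** On a cycle i -> x -> z -> i with [i < m], the second image of x and the first image of z are
    i. *)
Definition orbit_letter (t : nat -> nat) (m p : nat) : option bool :=
  if t (t p) < m then Some true else if t p < m then Some false else None.

Definition orbit_word (n : nat) (t : nat -> nat) (m : nat) : seq (option bool) :=
  [seq orbit_letter t m p | p <- iota m (n - m)].

Definition encode (n : nat) (t : nat -> nat) : seq nat * seq (option bool) :=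
  let m := cycle_minima n t in
  let u := orbit_word n t m in
  ([seq index (t i) (positions m u (Some true)) | i <- iota 0 m], u).

(** * The code of a permutation *)

Section Encode.
Variables (n : nat) (t : nat -> nat) (m : nat).
Hypothesis ht : cubic_av132 n t.
Hypothesis hm : threshold n t m.

Let lmn : m <= n := thr_le hm.
Let u := orbit_word n t m.
Let Xs := positions m u (Some true).
Let Zs := positions m u (Some false).
Let tn i : i < n -> t i < n := @cav_lt _ _ ht i.
Let t3 i : i < n -> t (t (t i)) = i := @cav_cube _ _ ht i.

Lemma thr_small2 i : i < m -> m <= t (t i).
Proof.
move=> lim; rewrite leqNgt; apply/negP => /(thr_small hm).
by rewrite t3; lia.
Qed.

(* An increasing map has no cycle but fixed points. *)
Lemma thr_fixed p : p < n -> m <= p -> m <= t p -> m <= t (t p) -> t p = p.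
Proof.
move=> lpn lmp h1 h2; have := t3 lpn; have := tn lpn; have := tn (tn lpn).
move=> l2 l1 e; have inc := thr_incr hm.
case: (ltngtP (t p) p) => // h.
- have h3 := inc _ _ h1 h lpn h2 h1.
  by have := inc _ _ h2 h3 l1; rewrite e => /(_ lmp h2); lia.
- have h3 := inc _ _ lmp h l1 h1 h2.
  by have := inc _ _ h1 h3 l2; rewrite e => /(_ h2 lmp); lia.
Qed.

(** Every [i < m] is the minimum of its 3-cycle, as both images are at least [m]. From [m] on, a
    point with two larger images would be fixed by [thr_fixed]. *)
Lemma cycle_minima_thr : cycle_minima n t = m.
Proof.
rewrite /cycle_minima -{1}(subnKC lmn) iotaD count_cat add0n.
rewrite (_ : count _ (iota m _) = 0).
  rewrite addn0 -[RHS](size_iota 0); apply/eqP; rewrite -all_count; apply/allP => i.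
  rewrite mem_iota => h; have lim : i < m by lia.
  by have := thr_small hm lim; have := thr_small2 lim; lia.
apply/eqP; rewrite -leqn0 leqNgt -has_count; apply/hasPn => i.
rewrite mem_iota => h; have lin : i < n by lia.
apply/negP => /andP[h1 h2].
by have := thr_fixed lin; lia.
Qed.

Lemma size_orbit_word : size u = n - m.
Proof. by rewrite size_map size_iota. Qed.

Lemma nth_orbit_word p : m <= p < n -> nth None u (p - m) = orbit_letter t m p.
Proof.
move=> hp; rewrite (nth_map 0) ?size_iota; last by lia.
by rewrite nth_iota; [congr orbit_letter|]; lia.
Qed.

Lemma mem_Xs p : (p \in Xs) = (m <= p < n) && (t (t p) < m).
Proof.
rewrite mem_positions size_orbit_word subnKC //; apply: andb_id2l => hp.
by rewrite nth_orbit_word // /orbit_letter; case: ltnP => // _; case: ltnP.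
Qed.

Lemma mem_Zs p : (p \in Zs) = (m <= p < n) && (t p < m).
Proof.
rewrite mem_positions size_orbit_word subnKC //; apply: andb_id2l => hp.
rewrite nth_orbit_word // /orbit_letter; case: ltnP => h; last by case: ltnP.
by apply/esym/negbTE; rewrite -leqNgt leqNgt; apply/negP => /(thr_small hm); lia.
Qed.

Lemma small_Xs i : i < m -> t i \in Xs.
Proof.
move=> lim; have lin : i < n by lia.
by rewrite mem_Xs (thr_small hm lim) tn // t3.
Qed.

(** [t] is increasing on the X's and maps them onto the Z's, so two sorted lists with the same
    members are compared: the k-th X goes to the k-th Z. *)
Lemma map_Xs : map t Xs = Zs.
Proof.
apply: (irr_sorted_eq ltn_trans ltnn).
- apply: (homo_sorted_in (P := mem Xs) (e := ltn)); last exact: positions_sorted.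
    move=> p q; rewrite !mem_Xs => /andP[/andP[hp1 hp2] hp3] /andP[/andP[hq1 hq2] hq3] lpq.
    apply: (thr_incr hm) => //.
      by rewrite leqNgt; apply/negP => /(thr_small hm); lia.
    by rewrite leqNgt; apply/negP => /(thr_small hm); lia.
  exact/allP.
- exact: positions_sorted.
move=> p; apply/mapP/idP => [[q]|].
  rewrite mem_Xs mem_Zs => /andP[/andP[h1 h2] h3] ->.
  rewrite h3 tn // leqNgt !andbT; apply/negP => /(thr_small hm); lia.
rewrite mem_Zs => /andP[/andP[h1 h2] h3]; exists (t (t p)); last by rewrite t3.
rewrite mem_Xs (thr_small hm h3) !tn //= t3 // tn //.
Qed.

Lemma perm_small_Xs : perm_eq (map t (iota 0 m)) Xs.
Proof.
apply: uniq_perm; last 1 first.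
- move=> p; apply/mapP/idP => [[i]|].
    by rewrite mem_iota => lim ->; apply: small_Xs.
  rewrite mem_Xs => /andP[/andP[h1 h2] h3]; exists (t (t p)); last by rewrite t3.
  by rewrite mem_iota.
- rewrite map_inj_in_uniq ?iota_uniq // => i j; rewrite !mem_iota => hi hj.
  by apply: (cav_inj ht); lia.
- exact: positions_uniq.
Qed.

Lemma size_Xs : size Xs = m.
Proof. by rewrite -(perm_size perm_small_Xs) size_map size_iota. Qed.

Lemma size_Zs : size Zs = m.
Proof. by rewrite -map_Xs size_map size_Xs. Qed.

Let sg := [seq index (t i) Xs | i <- iota 0 m].

Lemma encode_thr : encode n t = (sg, u).
Proof. by rewrite /encode cycle_minima_thr. Qed.

Let size_sg : size sg = m. Proof. by rewrite size_map size_iota. Qed.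

Let nth_sg i : i < m -> nth 0 sg i = index (t i) Xs.
Proof. by move=> lim; rewrite (nth_map 0) ?size_iota // nth_iota. Qed.

Let nth_sg_lt i : i < m -> nth 0 sg i < m.
Proof. by move=> lim; rewrite nth_sg // -[X in _ < X]size_Xs index_mem small_Xs. Qed.

Lemma nth_Xs_sg i : i < m -> nth 0 Xs (nth 0 sg i) = t i.
Proof. by move=> lim; rewrite nth_sg // nth_index // small_Xs. Qed.

Lemma nth_Zs_sg i : i < m -> nth 0 Zs (nth 0 sg i) = t (t i).
Proof. by move=> lim; rewrite -map_Xs (nth_map 0) ?nth_Xs_sg // size_Xs nth_sg_lt. Qed.

Lemma perm_sg : perm_eq sg (iota 0 m).
Proof.
have usg : uniq sg.
  rewrite map_inj_in_uniq ?iota_uniq // => i j; rewrite !mem_iota !add0n /= => hi hj e.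
  apply: (cav_inj ht); [lia|lia|].
  by rewrite -(nth_index 0 (small_Xs hi)) e nth_index // small_Xs.
apply: uniq_perm; rewrite ?iota_uniq //.
apply: (uniq_min_size usg _ _).2; last by rewrite size_iota size_sg.
by move=> a /(nthP 0)[i]; rewrite size_sg => lim <-; rewrite mem_iota nth_sg_lt.
Qed.

Let count_Xs : count_mem (Some true) u = m.
Proof. by rewrite -(size_positions m) size_Xs. Qed.
Let count_Zs : count_mem (Some false) u = m.
Proof. by rewrite -(size_positions m) size_Zs. Qed.

Lemma av132_sg : av132 sg.
Proof.
apply/av132P => i j k lij ljk; rewrite size_sg => lkm.
have lj : j < m by lia. have li : i < m by lia.
have key x y : x < m -> y < m -> (nth 0 sg x < nth 0 sg y) = (t x < t y).
  by move=> lx ly; rewrite -!nth_Xs_sg // nth_positions_ltn ?count_Xs ?nth_sg_lt.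
by rewrite !key //; apply: (cav_av ht) => //; lia.
Qed.

Lemma block_word_encode : block_word (skew_cut sg) m 0 0 u.
Proof.
apply/block_wordP => //; rewrite !add0n; split=> // k; rewrite size_orbit_word => lk /=.
rewrite !add0n; pose p := m + k; have -> : k = p - m by rewrite /p addKn.
have hp : m <= p < n by rewrite /p; lia.
have hp' : m <= p <= m + size u by rewrite size_orbit_word; lia.
have ltp a x : a < count_mem x u ->
    (a < count_mem x (take (p - m) u)) = (nth 0 (positions m u x) a < p).
  by move=> ha; rewrite nth_positions_lt.
have lp : p < n by lia.
rewrite nth_orbit_word //; split.
(* An uncut X-count gives [i < j < m] with [t i < p <= t j]. If [p] is not an X, its preimage
   [t (t p)] is at least [m > j], and [i], [j], [t (t p)] carry a 132. *)
- rewrite -implyNb; apply/implyP => /skew_cutPn[i [j [lij]]].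
  rewrite size_sg => ljm /andP[h1 h2]; have lim := ltn_trans lij ljm.
  move: h1 h2; rewrite ltp ?count_Xs ?nth_sg_lt // nth_Xs_sg // => h1.
  rewrite leqNgt ltp ?count_Xs ?nth_sg_lt // nth_Xs_sg // -leqNgt => h2.
  rewrite /orbit_letter; case: (ltnP _ m) => // h3.
  exfalso; have h4 : t j <> p.
    by move=> e; have := small_Xs ljm; rewrite mem_Xs e; lia.
  have := @cav_av _ _ ht i j (t (t p)) lij; rewrite t3 // tn ?tn //.
  by lia.
(* Here [t (t i) < p <= t (t j)]. If [t p >= m], the positions [t (t i)], [p], [t (t j)] carry the
   values [i], [t p], [j], which form a 132. *)
- rewrite -implyNb; apply/implyP => /skew_cutPn[i [j [lij]]].
  rewrite size_sg => ljm /andP[h1 h2]; have lim := ltn_trans lij ljm.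
  move: h1 h2; rewrite ltp ?count_Zs ?nth_sg_lt // nth_Zs_sg // => h1.
  rewrite leqNgt ltp ?count_Zs ?nth_sg_lt // nth_Zs_sg // -leqNgt => h2.
  have lin : i < n by lia. have ljn : j < n by lia.
  suff h : t p < m.
    rewrite /orbit_letter h; case: ltnP => // h3.
    by have := thr_small hm h; lia.
  rewrite ltnNge; apply/negP => h3.
  have h4 : t (t j) <> p by move=> e; have := t3 ljn; rewrite e; lia.
  have := @cav_av _ _ ht (t (t i)) p (t (t j)) h1; rewrite !t3 // !tn //.
  by lia.
(* At a fixed point [p], monotonicity puts an X before [p] exactly when its image, the Z of the same
   rank, is before [p]. *)
- rewrite /orbit_letter; case: ltnP => // h1; case: ltnP => // h2 _.
  have fp : t p = p by apply: thr_fixed => //; lia.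
  have key a : a < m -> (a < count_mem (Some true) (take (p - m) u)) =
                        (a < count_mem (Some false) (take (p - m) u)).
    move=> lam; rewrite !ltp ?count_Xs ?count_Zs //.
    rewrite -/Xs -/Zs -map_Xs (nth_map 0) ?size_Xs //.
    have := @mem_nth _ 0 Xs a; rewrite size_Xs => /(_ lam).
    set q := nth 0 Xs a; rewrite mem_Xs => /andP[/andP[hq1 hq2] hq3].
    have lmtq : m <= t q by rewrite leqNgt; apply/negP => /(thr_small hm); lia.
    have inc := thr_incr hm.
    case: (ltngtP q p) => h.
    + by have := inc q p hq1 h lp lmtq; rewrite fp => ->; lia.
    + have := inc p q _ h hq2; rewrite fp => hh; apply/esym/negbTE.
      by have := hh _ _ lmtq; lia.
    + by move: hq3; rewrite h fp; lia.
  have cle x : count_mem x (take (p - m) u) <= count_mem x u.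
    by rewrite -{2}(cat_take_drop (p - m) u) count_cat leq_addr.
  have := cle (Some true); have := cle (Some false); rewrite count_Xs count_Zs.
  set cX := count_mem _ _ in key *; set cZ := count_mem _ _ in key *.
  (* If the counts differed, the smaller one would be a rank below [m] that tells them apart. *)
  by move=> lZ lX; case: (ltngtP cX cZ) => // h; have := key (minn cX cZ); lia.
Qed.

End Encode.

Definition valid_code (n : nat) (c : seq nat * seq (option bool)) : bool :=
  let m := size c.1 in
  [&& av132 c.1, perm_eq c.1 (iota 0 m), m <= n, size c.2 == n - m
    & block_word (skew_cut c.1) m 0 0 c.2].

Lemma encode_valid n t : cubic_av132 n t -> valid_code n (encode n t).
Proof.
move=> ht; have [m hm] := threshold_ex ht; rewrite (encode_thr ht hm) /valid_code /=.
rewrite !size_map !size_iota (av132_sg ht hm) (perm_sg ht hm) (thr_le hm) eqxx.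
exact: (block_word_encode ht hm).
Qed.

(** The code gives [t i] and [t (t i)] for [i < m], hence all 3-cycles; every other point is
    fixed. *)
Lemma encode_inj n t t' : cubic_av132 n t -> cubic_av132 n t' ->
  encode n t = encode n t' -> forall p, p < n -> t p = t' p.
Proof.
move=> ht ht'; have [m hm] := threshold_ex ht; have [m' hm'] := threshold_ex ht'.
rewrite (encode_thr ht hm) (encode_thr ht' hm') => -[esg eu] p lpn.
have em : m = m' by have := congr1 size esg; rewrite !size_map !size_iota.
subst m'; have t1 i : i < m -> t i = t' i.
  move=> lim; rewrite -(nth_Xs_sg ht hm lim) -(nth_Xs_sg ht' hm' lim).
  by rewrite esg eu.
have t2 i : i < m -> t (t i) = t' (t' i).
  move=> lim; rewrite -(nth_Zs_sg ht hm lim) -(nth_Zs_sg ht' hm' lim).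
  by rewrite esg eu.
have lmn := thr_le hm.
have [lpm|lmp] := ltnP p m; first exact: t1.
have [h|h2] := ltnP (t (t p)) m.
  have := t1 _ h; rewrite (cav_cube ht lpn) => e.
  by have := t2 _ h; rewrite (cav_cube ht lpn) -e.
have [h|h1] := ltnP (t p) m.
  have := t2 _ h; rewrite (cav_cube ht lpn) => e.
  by rewrite [in RHS]e (cav_cube ht') //; lia.
have hp : m <= p < n by lia.
have := nth_orbit_word hm' hp; rewrite -eu (nth_orbit_word hm hp) /orbit_letter.
rewrite ltnNge h2 ltnNge h1 /=; case: ltnP => // h2'; case: ltnP => // h1' _.
by rewrite (thr_fixed ht hm) // (thr_fixed ht' hm').
Qed.

(** A cycle goes from [i < m] to the X of rank [nth 0 c.1 i], then to the Z of the same rank, and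
    back to [i]. *)
Definition decode (c : seq nat * seq (option bool)) (i : nat) : nat :=
  let m := size c.1 in
  if i < m then nth 0 (positions m c.2 (Some true)) (nth 0 c.1 i) else
  match nth None c.2 (i - m) with
  | Some true => nth 0 (positions m c.2 (Some false)) (index i (positions m c.2 (Some true)))
  | Some false => index (index i (positions m c.2 (Some false))) c.1
  | None => i
  end.

(** * Decoding a valid code *)

Section Decode.
Variables (n : nat) (sg : seq nat) (u : seq (option bool)).
Hypothesis hv : valid_code n (sg, u).

Let m := size sg.
Let P b := positions m u (Some b).
Let Xs := P true.
Let Zs := P false.
Let t := decode (sg, u).
Let letter p := nth None u (p - m).

Let av_sg : av132 sg. Proof. by case/and5P: hv. Qed.
Let perm_sg : perm_eq sg (iota 0 m). Proof. by case/and5P: hv. Qed.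
Let lmn : m <= n. Proof. by case/and5P: hv. Qed.
Let size_u : size u = n - m. Proof. by case/and5P: hv => _ _ _ /eqP. Qed.
Let bw : block_word (skew_cut sg) m 0 0 u. Proof. by case/and5P: hv. Qed.

Let count_letter b : count_mem (Some b) u = m.
Proof.
have /block_wordP [] // := bw; rewrite !add0n => hX hZ _.
by case: b.
Qed.

Let uniq_sg : uniq sg. Proof. by rewrite (perm_uniq perm_sg) iota_uniq. Qed.

Let sg_lt i : i < m -> nth 0 sg i < m.
Proof. by move=> lim; apply: (perm_iota_lt perm_sg); apply: mem_nth. Qed.

Let index_sg i : i < m -> index (nth 0 sg i) sg = i.
Proof. by move=> lim; rewrite index_uniq. Qed.

Let sg_index a : a < m -> nth 0 sg (index a sg) = a.
Proof. by move=> lam; rewrite nth_index // (perm_mem perm_sg) mem_iota. Qed.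

Let index_lt a : a < m -> index a sg < m.
Proof. by move=> lam; rewrite index_mem (perm_mem perm_sg) mem_iota. Qed.

Let nth_P b a : a < m ->
  [/\ m <= nth 0 (P b) a, nth 0 (P b) a < n & letter (nth 0 (P b) a) = Some b].
Proof.
move=> lam; have : nth 0 (P b) a \in P b.
  by apply: mem_nth; rewrite size_positions count_letter.
by rewrite mem_positions size_u subnKC // => /andP[/andP[-> ->] /eqP].
Qed.

Let index_P b a : a < m -> index (nth 0 (P b) a) (P b) = a.
Proof.
by move=> lam; rewrite index_uniq ?positions_uniq // size_positions count_letter.
Qed.

Let P_ltn b a a' : a < m -> a' < m -> (nth 0 (P b) a < nth 0 (P b) a') = (a < a').
Proof. by move=> la la'; apply: nth_positions_ltn; rewrite count_letter. Qed.

Let t_small i : i < m -> t i = nth 0 Xs (nth 0 sg i).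
Proof. by move=> lim; rewrite /t /decode /= -/m lim. Qed.

Let t_X a : a < m -> t (nth 0 Xs a) = nth 0 Zs a.
Proof.
move=> lam; have [h1 _ h2] := nth_P true lam.
rewrite /t /decode /= -/m ltnNge h1 /= -/(letter _) h2.
by rewrite -/Xs -/Zs index_P.
Qed.

Let t_Z a : a < m -> t (nth 0 Zs a) = index a sg.
Proof.
move=> lam; have [h1 _ h2] := nth_P false lam.
rewrite /t /decode /= -/m ltnNge h1 /= -/(letter _) h2.
by rewrite -/Zs index_P.
Qed.

Let t_F p : m <= p -> letter p = None -> t p = p.
Proof.
by move=> lmp h; rewrite /t /decode /= -/m ltnNge lmp /= -/(letter _) h.
Qed.

Let letterP p b : m <= p < n -> letter p = Some b ->
  exists2 a, a < m & p = nth 0 (P b) a.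
Proof.
move=> hp h; have pP : p \in P b by rewrite mem_positions size_u subnKC // hp; apply/eqP.
exists (index p (P b)); last by rewrite nth_index.
by rewrite -(count_letter b) -(size_positions m) index_mem.
Qed.

Let caseP p : p < n ->
  [\/ p < m, exists2 a, a < m & p = nth 0 Xs a,
      exists2 a, a < m & p = nth 0 Zs a | m <= p /\ letter p = None].
Proof.
move=> lpn; have [lpm|lmp] := ltnP p m; first by constructor 1.
have hp : m <= p < n by rewrite lmp.
case E: (letter p) => [[]|]; last by constructor 4.
  by constructor 2; apply: letterP.
by constructor 3; apply: letterP.
Qed.

Let t_lt p : p < n -> t p < n.
Proof.
move=> lpn; case: (caseP lpn) => [lpm|[a la ->]|[a la ->]|[lmp h]].
- by rewrite t_small //; have [] := nth_P true (sg_lt lpm).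
- by rewrite t_X //; have [] := nth_P false la.
- by rewrite t_Z //; have := index_lt la; lia.
- by rewrite t_F.
Qed.

Let t_cube p : p < n -> t (t (t p)) = p.
Proof.
move=> lpn; case: (caseP lpn) => [lpm|[a la ->]|[a la ->]|[lmp h]].
- by rewrite (t_small lpm) t_X ?sg_lt // t_Z ?sg_lt // index_sg.
- by rewrite t_X // t_Z // t_small ?index_lt // sg_index.
- by rewrite t_Z // (t_small (index_lt la)) sg_index // t_X.
- by rewrite !(t_F lmp h).
Qed.

Let small_val p : p < n -> t p < m -> exists2 a, a < m & p = nth 0 Zs a.
Proof.
move=> lpn h; case: (caseP lpn) => // [lpm|[a la e]|[lmp e]]; move: h.
- by rewrite t_small // ltnNge; have [-> _ _] := nth_P true (sg_lt lpm).
- by rewrite e t_X // ltnNge; have [-> _ _] := nth_P false la.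
- by rewrite t_F // ltnNge lmp.
Qed.

Let local p : m <= p < n ->
  let c b := count_mem (Some b) (take (p - m) u) in
  (forall b, skew_cut sg (c b) || (letter p == Some b)) /\
  (letter p = None -> c true = c false).
Proof.
move=> hp; have /block_wordP [] // := bw => _ _ h.
have [|h1 h2 h3] := h (p - m); first by rewrite size_u; lia.
by split=> // -[].
Qed.

Let count_lt b a p : a < m -> m <= p < n ->
  (a < count_mem (Some b) (take (p - m) u)) = (nth 0 (P b) a < p).
Proof.
by move=> la hp; rewrite nth_positions_lt ?count_letter // size_u; lia.
Qed.

(** A non-inversion [i < j] puts the ranks of [i] and [j] in one component, whose letters must be
    adjacent; so every position between them carries the same letter. *)
Let glue b i j p : i < j -> j < m -> m <= p < n ->
  nth 0 (P b) (nth 0 sg i) < p -> p < nth 0 (P b) (nth 0 sg j) -> letter p = Some b.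
Proof.
move=> lij ljm hp h1 h2; have [/(_ b) hc _] := local hp.
have lim := ltn_trans lij ljm.
apply/eqP; move: hc; rewrite -implyNb => /implyP; apply; apply/skew_cutPn.
exists i, j; split=> //; rewrite count_lt ?sg_lt // h1 /=.
by rewrite leqNgt count_lt ?sg_lt // -leqNgt ltnW.
Qed.

(** Only X's and fixed points have position and value at least [m]. X's map to Z's in order, and
    [bal], the balance of the word at an F, settles the mixed cases. *)
Let t_incr p q : m <= p -> p < q -> q < n -> m <= t p -> m <= t q -> t p < t q.
Proof.
move=> lmp lpq lqn.
have bal a r : a < m -> m <= r < n -> letter r = None ->
    (nth 0 Xs a < r) = (nth 0 Zs a < r).
  by move=> la hr e; have [_ /(_ e) h] := local hr; rewrite -!count_lt // h.
have lpn := ltn_trans lpq lqn; have lmq : m <= q by lia.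
case: (caseP lpn) => [|[a la ep]|[a la ->]|[_ ep]]; first by rewrite ltnNge lmp.
- case: (caseP lqn) => [|[b lb eq]|[b lb ->]|[_ eq]]; first by rewrite ltnNge lmq.
  + by move: lpq; rewrite ep eq !t_X // !P_ltn.
  + by rewrite t_Z // [m <= index _ _]leqNgt index_lt.
  + by rewrite ep t_X // (t_F lmq eq) -bal ?lmq // -ep.
- by rewrite t_Z // [m <= index _ _]leqNgt index_lt.
- rewrite (t_F lmp ep).
  case: (caseP lqn) => [|[b lb eq]|[b lb ->]|[_ eq]]; first by rewrite ltnNge lmq.
  + rewrite eq t_X // => _ _; have := bal b p lb; rewrite lmp lpn => /(_ isT ep).
    rewrite -eq [q < p]ltnNge ltnW //= => /esym/negbT; rewrite -leqNgt leq_eqVlt.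
    case/orP=> // /eqP e; have [_ _] := nth_P false lb.
    by rewrite -/Zs -e ep.
  + by rewrite t_Z // [m <= index _ _]leqNgt index_lt.
  + by rewrite (t_F lmq eq).
Qed.

(** The cases depend on which positions and values are below [m]. A 132 then either lies in [sg], or
    contradicts [t_incr], or breaks a component and contradicts [glue]. *)
Let t_av i j k : i < j -> j < k -> k < n -> ~~ (t i < t k < t j).
Proof.
move=> lij ljk lkn; apply/negP => /andP[hik hkj].
have ljn := ltn_trans ljk lkn; have lin := ltn_trans lij ljn.
have lik := ltn_trans lij ljk.
have [hi|hi] := ltnP (t i) m.
  have [a la ei] := small_val lin hi.
  have lmi : m <= i by rewrite ei; have [] := nth_P false la.
  (* If all three values are small, the positions are Z's and the pattern lies in the inverse of
     [sg]; 132 is its own inverse. *)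
  have [hj|hj] := ltnP (t j) m.
    have [b lb ej] := small_val ljn hj.
    have [c lc ek] := small_val lkn (ltn_trans hkj hj).
    have := (av132P _ av_sg) (index a sg) (index c sg) (index b sg).
    rewrite -!t_Z // -ei -ej -ek hik hkj => /(_ isT isT hj).
    rewrite ei ej ek !t_Z // !sg_index // -(P_ltn false la lb) -(P_ltn false lb lc).
    by rewrite -/Zs -ei -ej -ek lij ljk.
  have [hk|hk] := ltnP (t k) m; last first.
    by have := t_incr (leq_trans lmi (ltnW lij)) ljk lkn hj hk; lia.
  (* Now [i] and [k] are Z's of one component with [j] between them, so [glue] makes [j] a Z,
     against [m <= t j]. *)
  have [c lc ek] := small_val lkn hk.
  have lj : m <= j < n by lia.
  have := @glue false (index a sg) (index c sg) j.
  rewrite -!t_Z // -ei -ek ei ek !t_Z // !sg_index // -/Zs -ei -ek.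
  rewrite -(t_Z la) -(t_Z lc) -ei -ek => /(_ hik hk lj lij ljk) /(letterP lj) [b lb ej].
  by move: hj; rewrite ej t_Z // leqNgt index_lt.
have hk : m <= t k by lia.
have hj : m <= t j by lia.
have [ljm|lmj] := ltnP j m; last by have := t_incr lmj ljk lkn hj hk; lia.
have lim := ltn_trans lij ljm.
have sgE x y : x < m -> y < m -> (t x < t y) = (nth 0 sg x < nth 0 sg y).
  by move=> lx ly; rewrite !t_small // P_ltn ?sg_lt.
have [lkm|lmk] := ltnP k m.
  by have := (av132P _ av_sg) i j k lij ljk lkm; rewrite -!sgE // hik hkj.
(* The value [t k] lies between the X's [t i] and [t j], so [glue] makes it an X; but [k >= m], and
   its value is a Z, a fixed point or below [m]. *)
have htk : m <= t k < n by rewrite hk t_lt.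
have := @glue true i j (t k) lij ljm htk.
rewrite -/Xs -!t_small // => /(_ hik hkj).
case: (caseP lkn) => [|[a la e]|[a la e]|[_ e]]; first by rewrite ltnNge lmk.
- by rewrite e t_X //; have [_ _ ->] := nth_P false la.
- by move: hk; rewrite e t_Z // leqNgt index_lt.
- by rewrite t_F // e.
Qed.

Lemma decode_cav : cubic_av132 n t.
Proof. by split. Qed.

Lemma decode_thr : threshold n t m.
Proof.
split=> // i lim.
by rewrite t_small //; have [] := nth_P true (sg_lt lim).
Qed.

Lemma decodeK : encode n t = (sg, u).
Proof.
rewrite (encode_thr decode_cav decode_thr).
have -> : orbit_word n t m = u.
  apply: (@eq_from_nth _ None); first by rewrite size_map size_iota size_u.
  move=> k; rewrite size_map size_iota => lk.
  rewrite (nth_map 0) ?size_iota // nth_iota //; set p := m + k.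
  have -> : nth None u k = letter p by rewrite /letter /p addKn.
  have lpn : p < n by rewrite /p; lia.
  have lmp : m <= p by rewrite /p; lia.
  rewrite /orbit_letter; case: (caseP lpn) => [|[a la ->]|[a la ->]|[_ e]].
  - by rewrite ltnNge lmp.
  - by rewrite t_X // t_Z // index_lt //; have [_ _ ->] := nth_P true la.
  - rewrite t_Z // index_lt // t_small ?index_lt // sg_index // ltnNge.
    by have [-> _ _] := nth_P true la; have [_ _ ->] := nth_P false la.
  - by rewrite !(t_F lmp e) ltnNge lmp e.
congr pair; apply: (@eq_from_nth _ 0); first by rewrite size_map size_iota.
move=> i; rewrite size_map size_iota => lim.
by rewrite (nth_map 0) ?size_iota // nth_iota // t_small // index_P // sg_lt.
Qed.

End Decode.

(** * Counting the codes *)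

Definition codes (n : nat) : seq (seq nat * seq (option bool)) :=
  [seq c | m <- iota 0 n.+1,
     c <- [seq (s, u) | s <- av132_perms m,
             u <- [seq u <- words (n - m) | block_word (skew_cut s) m 0 0 u]]].

Lemma mem_codes n c : (c \in codes n) = valid_code n c.
Proof.
case: c => s u; apply/allpairsPdep/idP => [[m [c [hm hc ->]]]|].
  case/allpairsPdep: hc => s' [u' [hs hu ->]] {c}.
  move: hs hu hm; rewrite mem_av132_perms mem_filter mem_words mem_iota.
  move=> /andP[avs ps] /andP[bw /eqP szu] /= lmn.
  have sz : size s' = m by rewrite (perm_size ps) size_iota.
  by rewrite /valid_code /= sz avs ps szu eqxx bw -ltnS lmn.
case/and5P=> avs ps lmn szu bw; rewrite /= in avs ps lmn szu bw; exists (size s), (s, u).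
split; [by rewrite mem_iota | | by []].
apply/allpairsPdep; exists s, u; split=> //; first by rewrite mem_av132_perms avs.
by rewrite mem_filter mem_words szu bw.
Qed.

Lemma codes_uniq n : uniq (codes n).
Proof.
apply: allpairs_uniq_dep; first exact: iota_uniq.
  move=> m _; apply: allpairs_uniq_dep; first exact: av132_perms_uniq.
    by move=> s _; apply/filter_uniq/words_uniq.
  by move=> [? ?] [? ?] _ _ /= [-> ->].
move=> t1 t2 /allpairsPdep[m [c [_ hc ->]]] /allpairsPdep[m' [c' [_ hc' ->]]] /= e.
have sz k d : d \in [seq (s, u) | s <- av132_perms k,
    u <- [seq u <- words (n - k) | block_word (skew_cut s) k 0 0 u]] -> size d.1 = k.
  case/allpairsPdep=> s [u [hs _ ->]] /=; move: hs; rewrite mem_av132_perms.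
  by case/andP=> _ /perm_size; rewrite size_iota.
by have := sz _ _ hc; rewrite e (sz _ _ hc') => ->.
Qed.

(** With [m] three-cycles there remain [n - 3 * m] fixed points, the F's of the word. *)
Definition code_count (n : nat) : nat :=
  \sum_(m < n.+1 | 3 * m <= n) skew_sum m (fun r => bridges (n - 3 * m) r r).

Lemma size_codes n : size (codes n) = code_count n.
Proof.
rewrite /code_count size_allpairs_dep sumnE big_map -(big_mkord (fun m => 3 * m <= n)
  (fun m => skew_sum m (fun r => bridges (n - 3 * m) r r))) /index_iota subn0.
rewrite [RHS]big_mkcond !big_seq; apply: eq_bigr => m; rewrite mem_iota => /andP[_ lmn].
rewrite size_allpairs_dep sumnE big_map /skew_sum.
case: (leqP (3 * m) n) => h; last first.
  apply: big1 => s _; rewrite size_filter; apply/eqP.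
  rewrite -leqn0 leqNgt -has_count; apply/hasPn => u; rewrite mem_words => /eqP szu.
  by apply/negP => /block_word_size; rewrite szu; lia.
rewrite !big_seq; apply: eq_bigr => s; rewrite mem_av132_perms => /andP[_ hs].
have sz : size s = m by rewrite (perm_size hs) size_iota.
rewrite size_filter.
have -> : n - m = (m - 0) + (m - 0) + (n - 3 * m) by lia.
rewrite count_block_word ?skew_cut0 ?(skew_cut_size hs) //.
by rewrite !subn0 /cuts_after subn0 /skew_blocks sz.
Qed.

(** * Permutations of ['I_n] as functions on naturals *)

Section PermFun.
Variables (n : nat) (s : {perm 'I_n}).

Definition perm_fun (i : nat) : nat := if insub i is Some o then val (s o) else i.

Lemma perm_funE (i : 'I_n) : perm_fun i = s i.
Proof. by rewrite /perm_fun valK. Qed.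

(** If the cube of [s] is 1, orbit sizes divide 3, which is prime. *)
Lemma cycles13E : cycles13 s = [forall x, s (s (s x)) == x].
Proof.
apply/forallP/forallP => h x.
  have := h x; case/orP=> /eqP e; have := iter_porbit s x; rewrite e /=.
    by move=> ex; rewrite !ex.
  by move=> ->.
have s3 : (s ^+ 3 = 1)%g.
  by apply/permP => y; rewrite perm1 !expgS expg0 mulg1 !permM; apply/eqP.
have := dvdn_orbit 'P <[s]>%g x; rewrite -porbitE.
move/dvdn_trans => /(_ 3); rewrite -/(order s) order_dvdn s3 eqxx => /(_ isT).
by move/(proj2 (primeP (isT : prime 3))); rewrite orbC.
Qed.

Lemma cav_perm_fun : cubic_av132 n perm_fun <-> avoids132 s && cycles13 s.
Proof.
rewrite cycles13E; split=> [[hlt h3 hav]|/andP[hav /forallP h3]].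
  apply/andP; split; last first.
    by apply/forallP => x; apply/eqP/val_inj; rewrite /= -!perm_funE h3.
  apply/existsPn => i; apply/existsPn => j; apply/existsPn => k.
  apply/negP => /and4P[lij ljk h1 h2].
  by have := hav i j k lij ljk (ltn_ord k); rewrite !perm_funE h1 h2.
split=> [i li|i li|i j k lij ljk lk].
- by rewrite (perm_funE (Ordinal li)).
- by rewrite (perm_funE (Ordinal li)) !perm_funE (eqP (h3 _)).
- have lj := ltn_trans ljk lk; have li := ltn_trans lij lj.
  rewrite (perm_funE (Ordinal li)) (perm_funE (Ordinal lj)) (perm_funE (Ordinal lk)).
  apply/negP => /andP[h1 h2]; case/existsP: hav; exists (Ordinal li).
  apply/existsP; exists (Ordinal lj); apply/existsP; exists (Ordinal lk).
  by rewrite /= lij ljk h1 h2.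
Qed.

End PermFun.

Lemma perm_fun_surj n t : cubic_av132 n t ->
  exists s : {perm 'I_n}, forall i, i < n -> perm_fun s i = t i.
Proof.
move=> ht; pose f (i : 'I_n) := Ordinal (cav_lt ht (ltn_ord i)).
have injf : injective f.
  by move=> i j /(congr1 val) /= /(cav_inj ht (ltn_ord i) (ltn_ord j)) /val_inj.
exists (perm injf) => i li.
by rewrite (perm_funE _ (Ordinal li)) permE.
Qed.

Lemma eq_cav n t t' : (forall i, i < n -> t i = t' i) ->
  cubic_av132 n t -> cubic_av132 n t'.
Proof.
move=> e [hlt h3 hav]; split=> [i li|i li|i j k lij ljk lk].
- by rewrite -e ?hlt.
- by rewrite -(e i) // -(e (t i)) ?hlt // -(e (t (t i))) ?hlt // h3.
- by rewrite -!e ?hav //; lia.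
Qed.

(** Needed because a decoded function and the permutation built from it are only known to agree
    below [n]. *)
Lemma eq_encode n t t' : cubic_av132 n t -> (forall i, i < n -> t i = t' i) ->
  encode n t = encode n t'.
Proof.
move=> ht e; have hlt := @cav_lt _ _ ht.
have em : cycle_minima n t = cycle_minima n t'.
  apply: eq_in_count => i; rewrite mem_iota => /andP[_ li].
  by rewrite -(e i) // -(e (t i)) ?hlt.
have eu m : orbit_word n t m = orbit_word n t' m.
  apply/eq_in_map => p; rewrite mem_iota => hp.
  have lp : p < n by lia.
  by rewrite /orbit_letter -(e p) // -(e (t p)) ?hlt.
rewrite /encode em eu; congr pair; apply/eq_in_map => i; rewrite mem_iota => li.
rewrite e //; have : cycle_minima n t' <= n.
  by rewrite -[X in _ <= X](size_iota 0) count_size.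
by lia.
Qed.

Lemma a13E n : a13 n = code_count n.
Proof.
rewrite -size_codes /a13 cardE; set A := [set s | _].
rewrite -(size_map (fun s : {perm 'I_n} => encode n (perm_fun s))).
apply: perm_size; apply: uniq_perm; last 1 first.
- move=> c; rewrite mem_codes; apply/mapP/idP => [[s]|hc].
    rewrite mem_enum inE => /cav_perm_fun hs ->; exact: encode_valid.
  case: c hc => sg u hc; have ht := decode_cav hc.
  have [s hs] := perm_fun_surj ht; exists s.
    by rewrite mem_enum inE; apply/cav_perm_fun; apply: eq_cav ht => i li; rewrite hs.
  by rewrite -(decodeK hc); apply: eq_encode => // i li; rewrite hs.
- rewrite map_inj_in_uniq ?enum_uniq // => s s'.
  rewrite !mem_enum !inE => /cav_perm_fun hs /cav_perm_fun hs' /(encode_inj hs hs') e.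
  by apply/permP => i; apply: val_inj; rewrite /= -!perm_funE e.
- exact: codes_uniq.
Qed.

(** * Analytic generating functions *)

Definition conv (a b : nat -> nat) (n : nat) : nat :=
  \sum_(i < n.+1) a i * b (n - i).

(** The rate 16 covers all series involved: their coefficients grow at most like 4, 8 and 16 to the
    power n. *)
Definition geom_bounded (s : nat -> nat) : Prop := exists M, forall n, s n <= M * 16 ^ n.

Lemma geom_bounded_shift s : geom_bounded s -> geom_bounded (fun n => s n.+1).
Proof.
case=> M h; exists (M * 16) => n; apply: leq_trans (h _) _.
by rewrite expnS mulnA.
Qed.

Local Open Scope R_scope.

Section PowerSeries.
Variable z : R.
Hypothesis z_small : Rabs z < / 16.

Definition gf (s : nat -> nat) : R := PSeries (fun n => INR (s n)) z.

Lemma INR_pow16 n : INR (16 ^ n)%N = 16 ^ n.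
Proof.
elim: n => [|n IH] //; rewrite expnS -multE mult_INR IH /=.
by ring.
Qed.

Lemma gf_radius s : geom_bounded s ->
  Rbar_lt (Rabs z) (CV_radius (fun n => INR (s n))).
Proof.
case=> M h; apply: (Rbar_lt_le_trans _ (/ 16)) => //.
have [ub _] := CV_radius_bounded (fun n => INR (s n)); apply: ub.
exists (INR M) => n; rewrite Rabs_pos_eq; last first.
  by apply: Rmult_le_pos; [apply: pos_INR | apply: pow_le; lra].
have h16 : 0 < 16 ^ n by apply: pow_lt; lra.
rewrite pow_inv; apply: (Rmult_le_reg_r (16 ^ n)) => //.
rewrite Rmult_assoc Rinv_l ?Rmult_1_r; last by lra.
rewrite -INR_pow16 -mult_INR; apply/le_INR/leP; exact: h.
Qed.

Lemma gf_ex s : geom_bounded s -> ex_pseries (fun n => INR (s n)) z.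
Proof. by move/gf_radius; apply: CV_radius_inside. Qed.

Lemma gf_shift s : geom_bounded s -> gf s = INR (s 0%N) + z * gf (fun n => s n.+1).
Proof. by move=> /gf_ex hs; rewrite /gf PSeries_decr_1. Qed.

Lemma gf_ext s t : s =1 t -> gf s = gf t.
Proof. by move=> h; apply: PSeries_ext => n; rewrite h. Qed.

Lemma gf_add s t : geom_bounded s -> geom_bounded t ->
  gf (fun n => s n + t n)%N = gf s + gf t.
Proof.
move=> /gf_ex hs /gf_ex ht; rewrite /gf -PSeries_plus //.
by apply: PSeries_ext => n; rewrite plus_INR.
Qed.

Lemma gf_scale k s : gf (fun n => k * s n)%N = INR k * gf s.
Proof.
by rewrite /gf -PSeries_scal; apply: PSeries_ext => n; rewrite mult_INR.
Qed.

Lemma gf_conv s t : geom_bounded s -> geom_bounded t ->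
  gf (conv s t) = gf s * gf t.
Proof.
move=> /gf_radius hs /gf_radius ht; rewrite /gf -PSeries_mult //.
apply: PSeries_ext => n; rewrite /conv /PS_mult.
(* The summation bound is separated from the [n] in [n - i], so that induction on it goes
   through. *)
have -> k : INR (\sum_(i < k.+1) s i * t (n - i))%N =
    sum_f_R0 (fun i => INR (s i) * INR (t (n - i)%N)) k.
  elim: k => [|k IH]; first by rewrite big_ord1 mult_INR.
  by rewrite big_ord_recr plus_INR mult_INR IH.
by [].
Qed.

Lemma gf_infinite_sum s : geom_bounded s ->
  infinite_sum (fun n => INR (s n) * z ^ n) (gf s).
Proof.
by move=> /gf_ex hs; apply/is_series_Reals/is_pseries_R/PSeries_correct.
Qed.

End PowerSeries.

(** Being close to 1 later selects the right root of each quadratic equation. *)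
Lemma gf_near0 s : geom_bounded s -> s 0%N = 1%N ->
  exists2 d, 0 < d & forall z, Rabs z < d -> Rabs (gf z s - 1) < / 2.
Proof.
move=> hs s0; have r0 : Rabs 0 < / 16 by rewrite Rabs_R0; lra.
have := PSeries_continuity _ _ (gf_radius r0 hs).
move=> /(_ (/ 2) ltac:(lra)) [d [d0 h]]; exists d => // z hz.
have e0 : PSeries (fun n => INR (s n)) 0 = 1 by rewrite PSeries_0 s0.
(* The limit defining continuity leaves out the point 0 itself. *)
have [->|nz] := Req_dec z 0.
  by rewrite /gf e0 Rminus_diag Rabs_R0; lra.
have := h z; rewrite /= /R_dist e0 => h'; apply: h'; split.
  by split=> //; apply/not_eq_sym.
by rewrite Rminus_0_r.
Qed.

(** The discriminant [1 - 4 * w] is the square of [1 - 2 * w * c], which is positive because [w] is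
    small and [c < 3 / 2]. *)
Lemma catC_unique w c : Rabs w < / 16 -> Rabs (c - 1) < / 2 ->
  c = 1 + w * c ^ 2 -> catC w = c.
Proof.
move=> hw hc e; rewrite /catC; case: Req_EM_T => [w0|w0] /=.
  by rewrite e w0; ring.
have -> : 1 - 4 * w = (1 - 2 * w * c) ^ 2.
  have -> : (1 - 2 * w * c) ^ 2 = 1 - 4 * w * (c - w * c ^ 2) by ring.
  have -> : c - w * c ^ 2 = 1 by lra.
  by ring.
rewrite sqrt_pow2; first by field.
by split_Rabs; nra.
Qed.

(** Since [w * c ^ 2 = c - 1], the trinomial is [c ^ 2 * (1 - 4 * w * c)], and the last factor is
    [/ b ^ 2]. *)
Lemma sqrt_trinomial w c b : 0 < b -> 0 < c ->
  c = 1 + w * c ^ 2 -> b ^ 2 = 1 + 4 * w * c * b ^ 2 ->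
  sqrt (c * (4 - 3 * c)) = c / b.
Proof.
move=> b0 c0 ec eb.
have -> : c * (4 - 3 * c) = (c / b) ^ 2.
  have e1 : 1 - 4 * w * c = / b ^ 2.
    apply: (Rmult_eq_reg_r (b ^ 2)); last by apply: pow_nonzero; lra.
    by rewrite Rinv_l; [lra | apply: pow_nonzero; lra].
  have -> : (c / b) ^ 2 = c ^ 2 * / b ^ 2 by field; lra.
  rewrite -e1; have -> : c ^ 2 * (1 - 4 * w * c) = c ^ 2 - 4 * c * (w * c ^ 2) by ring.
  have -> : w * c ^ 2 = c - 1 by lra.
  by ring.
by apply: sqrt_pow2; apply/Rlt_le/Rdiv_lt_0_compat.
Qed.

(** With [x = c - 1] the radicand in [mtx] is [c * (4 - 3 * c)], and
    [4 * x = c * (1 - / b) * (1 + / b)]. The denominator then factors through [1 - z * b]. *)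
Lemma Ftx_closed_form z c b : 0 < b -> 0 < c -> z < 1 -> 0 < 1 - z * b ->
  sqrt (c * (4 - 3 * c)) = c / b -> c * (4 - 3 * c) = (c / b) ^ 2 ->
  / (1 - z) * Ftx (2 / (1 - z)) (c - 1) = b / (1 - z * b).
Proof.
move=> b0 c0 z1 zb hs hq; rewrite /Ftx /mtx.
have -> : 1 - 2 * (c - 1) - 3 * (c - 1) ^ 2 = c * (4 - 3 * c) by ring.
rewrite hs.
have e : 4 * (c - 1) = c * (1 - / b) * (1 + / b).
  apply: (Rmult_eq_reg_l c); last lra.
  have -> : c * (c * (1 - / b) * (1 + / b)) = c ^ 2 - (c / b) ^ 2 by field; lra.
  by rewrite -hq; ring.
have -> : c - 1 = c * (1 - / b) * (1 + / b) / 4 by lra.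
have -> : 1 - 2 * (2 / (1 - z)) * (c * (1 - / b) * (1 + / b) / 4)
    + c * (1 - / b) * (1 + / b) / 4 + c / b
  = c * (1 + / b) * ((1 - z * b) / b) / (1 - z).
  have -> : c * (1 - / b) * (1 + / b) / 4 = c - 1 by lra.
  have -> : 1 - 2 * (2 / (1 - z)) * (c - 1) + (c - 1) + c / b
     = c - (4 * (c - 1)) / (1 - z) + c / b by field; lra.
  by rewrite e; field; lra.
field; repeat split; try lra.
Qed.

(** The recurrences become C = 1 + z^3 C^2, B^2 = 1 + 4 z^3 C B^2 and A = B + z B A; for z small
    enough that B and C are near 1, both closed forms are algebra. *)
Lemma generating_function (c b a : nat -> nat) :
  geom_bounded c -> geom_bounded b -> geom_bounded a -> geom_bounded (conv b b) ->
  c 0%N = 1%N -> c 1%N = 0%N -> c 2%N = 0%N -> (forall n, c n.+3 = conv c c n) ->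
  b 0%N = 1%N -> conv b b 1%N = 0%N -> conv b b 2%N = 0%N ->
  (forall n, conv b b n.+3 = 4 * conv c (conv b b) n)%N ->
  a 0%N = 1%N -> (forall n, a n.+1 = b n.+1 + conv b a n)%N ->
  exists2 eps, 0 < eps & forall z, Rabs z < eps ->
    infinite_sum (fun n => INR (a n) * z ^ n)
      (/ (1 - z) * Ftx (2 / (1 - z)) (catC (z ^ 3) - 1)) /\
    infinite_sum (fun n => INR (a n) * z ^ n)
      (catC (z ^ 3) /
         (sqrt (catC (z ^ 3) * (4 - 3 * catC (z ^ 3))) - z * catC (z ^ 3))).
Proof.
move=> gc gb ga ge c0 c1 c2 cS b0 e1 e2 eS a0 aS.
have [dc dc0 hc] := gf_near0 gc c0; have [db db0 hb] := gf_near0 gb b0.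
exists (Rmin (/ 16) (Rmin dc db)); first by repeat apply: Rmin_glb_lt => //; lra.
move=> z hz.
have z16 : Rabs z < / 16 by apply: Rlt_le_trans hz (Rmin_l _ _).
have {}hc : Rabs (gf z c - 1) < / 2.
  by apply: hc; apply: Rlt_le_trans hz _; apply: Rle_trans (Rmin_r _ _) (Rmin_l _ _).
have {}hb : Rabs (gf z b - 1) < / 2.
  by apply: hb; apply: Rlt_le_trans hz _; apply: Rle_trans (Rmin_r _ _) (Rmin_r _ _).
have shift3 s : geom_bounded s -> s 0%N = 1%N -> s 1%N = 0%N -> s 2%N = 0%N ->
    gf z s = 1 + z ^ 3 * gf z (fun n => s n.+3).
  move=> gs s0 s1 s2; rewrite (gf_shift z16 gs) s0.
  rewrite (gf_shift z16 (geom_bounded_shift gs)) s1.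
  rewrite (gf_shift z16 (geom_bounded_shift (geom_bounded_shift gs))) s2 /=.
  by ring.
have ec : gf z c = 1 + z ^ 3 * gf z c ^ 2.
  rewrite {1}(shift3 c) // (gf_ext _ cS) (gf_conv z16) //.
  by ring.
have ee : gf z (conv b b) = gf z b ^ 2 by rewrite (gf_conv z16) //; ring.
have eb : gf z b ^ 2 = 1 + 4 * z ^ 3 * gf z c * gf z b ^ 2.
  rewrite -{1}ee (shift3 (conv b b)) //; last by rewrite /conv big_ord1 b0.
  rewrite (gf_ext _ eS) gf_scale (gf_conv z16) // ee [INR 4]/=.
  by ring.
have ea : gf z a = gf z b + z * gf z b * gf z a.
  have ga' : geom_bounded (conv b a).
    have [M h] := geom_bounded_shift ga; exists M => n; apply: leq_trans (h n).
    by rewrite aS leq_addl.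
  rewrite {1}(gf_shift z16 ga) a0 (gf_ext _ aS) gf_add //; last exact: geom_bounded_shift.
  have := gf_shift z16 gb; rewrite b0 (gf_conv z16) // [INR 1]/=.
  by lra.
have hS := gf_infinite_sum z16 ga.
move: (gf z a) (gf z b) (gf z c) ea eb ec hb hc hS {ee} => A B C ea eb ec hb hc hS.
have hw : Rabs (z ^ 3) < / 16.
  have -> : z ^ 3 = z * (z * z) by ring.
  by split_Rabs; nra.
have C0 : 0 < C by split_Rabs; lra.
have B0 : 0 < B by split_Rabs; lra.
have zB : 0 < 1 - z * B by split_Rabs; nra.
have z1 : z < 1 by split_Rabs; lra.
have sq := sqrt_trinomial B0 C0 ec eb.
have AE : A = B / (1 - z * B).
  by apply: (Rmult_eq_reg_r (1 - z * B)); [field_simplify; lra | lra].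
rewrite (catC_unique hw hc ec); split.
  rewrite (@Ftx_closed_form z C B) // -?AE // -sq pow2_sqrt //.
  (* The radicand is nonnegative because [sqrt] vanishes on negative numbers, while here it equals
     [C / B > 0]. *)
  apply: Rnot_lt_le => h; have : 0 < C / B by apply: Rdiv_lt_0_compat.
  by rewrite -sq sqrt_neg_0; lra.
have -> : C / (sqrt (C * (4 - 3 * C)) - z * C) = A.
  have h := Rmult_lt_0_compat _ _ C0 zB.
  by rewrite sq AE; field; repeat split; lra.
exact: hS.
Qed.

(** * Convolution identities *)

From mathcomp Require Import ring lra.
Import Order.TTheory GRing.Theory Num.Theory.
Local Close Scope R_scope.
Local Open Scope nat_scope.

Definition central_bin (r : nat) : nat := 'C(r.*2, r).

Lemma central_binS i : i.+1 * central_bin i.+1 = (4 * i + 2) * central_bin i.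
Proof.
apply/eqP; rewrite -(eqn_pmul2l (ltn0Sn i)); apply/eqP; rewrite /central_bin doubleS.
have h1 := mul_bin_diag i.*2.+2 i; have h2 := mul_bin_diag i.*2.+1 i.
rewrite /= in h1 h2; have h3 : 'C(i.*2.+1, i) = 'C(i.*2.+1, i.+1).
  by rewrite -[RHS]bin_sub; [congr 'C(_, _)|]; lia.
rewrite -h1 h3 mulnCA -h2; rewrite -muln2; ring.
Qed.

(* Weighting the convolution by the index and using the recurrence of the central
   binomials gives (n + 1) S_(n+1) = 4 (n + 1) S_n. *)
Lemma conv_central_bin n : conv central_bin central_bin n = 4 ^ n.
Proof.
pose b := central_bin; pose S n := \sum_(i < n.+1) b i * b (n - i).
have mom k : 2 * (\sum_(i < k.+1) i * (b i * b (k - i))) = k * S k.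
  rewrite mul2n -addnn {2}(reindex_inj rev_ord_inj) /= -big_split /= big_distrr /=.
  apply: eq_bigr => i _; rewrite subSS.
  have lik : i <= k by rewrite -ltnS.
  by rewrite subKn // [b (k - i) * _]mulnC -mulnDl subnKC.
elim: n => [|n IH]; first by rewrite /conv big_ord1.
suff : n.+1 * S n.+1 = n.+1 * 4 ^ n.+1.
  by move/eqP; rewrite eqn_pmul2l // => /eqP.
rewrite -mom big_ord_recl mul0n add0n.
transitivity (2 * \sum_(i < n.+1) (4 * (i * (b i * b (n - i))) + 2 * (b i * b (n - i)))).
  congr (2 * _); apply: eq_bigr => i _; rewrite subSS lift0.
  by rewrite mulnA [_ * b _.+1]central_binS -/(b i); ring.
rewrite big_split /= -!big_distrr /= -/(S n) mulnDr mulnCA mom.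
by rewrite /S -/b -/(conv b b n) IH expnS; ring.
Qed.

Local Open Scope ring_scope.

(** * Power series as integer polynomials modulo a power of X *)

Section CongrX.
Variable N : nat.
Implicit Types p q : {poly int}.

Definition eqX p q := exists k, p = q + k * 'X^N.

Lemma eqX_refl p : eqX p p.
Proof. by exists 0; rewrite mul0r addr0. Qed.

Lemma eqX_sym p q : eqX p q -> eqX q p.
Proof. by case=> k ->; exists (- k); ring. Qed.

Lemma eqX_trans q p r : eqX p q -> eqX q r -> eqX p r.
Proof. by case=> k -> [l ->]; exists (k + l); ring. Qed.

Lemma eqXD p q p' q' : eqX p q -> eqX p' q' -> eqX (p + p') (q + q').
Proof. by case=> k -> [l ->]; exists (k + l); ring. Qed.

Lemma eqXM p q p' q' : eqX p q -> eqX p' q' -> eqX (p * p') (q * q').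
Proof. by case=> k -> [l ->]; exists (k * q' + q * l + k * l * 'X^N); ring. Qed.

Lemma eqX_exp p q n : eqX p q -> eqX (p ^+ n) (q ^+ n).
Proof.
by move=> h; elim: n => [|n IH]; rewrite ?expr0 ?exprS; [apply: eqX_refl|apply: eqXM].
Qed.

Lemma eqX_sum n (F G : 'I_n -> {poly int}) : (forall i, eqX (F i) (G i)) ->
  eqX (\sum_(i < n) F i) (\sum_(i < n) G i).
Proof.
by move=> h; elim/big_ind2: _ => // [|p q p' q']; [apply: eqX_refl|apply: eqXD].
Qed.

(** Substituting a multiple of X turns ['X^N] into a multiple of ['X^N]. *)
Lemma eqX_comp p q r : eqX p q -> eqX (p \Po ('X * r)) (q \Po ('X * r)).
Proof.
case=> k ->; exists ((k \Po ('X * r)) * r ^+ N).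
rewrite comp_polyD comp_polyM rmorphXn /= comp_polyX exprMn; ring.
Qed.

Lemma eqXP p q : eqX p q <-> forall i, (i < N)%N -> p`_i = q`_i.
Proof.
split=> [[k ->] i li|h]; first by rewrite coefD coefMXn li addr0.
exists (drop_poly N (p - q)); apply/polyP => i; rewrite coefD coefMXn.
case: ltnP => li; first by rewrite h // addr0.
by rewrite coef_drop_poly subnK // coefB; ring.
Qed.

Definition npoly (s : nat -> nat) : {poly int} := \poly_(i < N) (s i)%:R.

Lemma coef_npoly s i : (i < N)%N -> (npoly s)`_i = (s i)%:R.
Proof. by move=> li; rewrite coef_poly li. Qed.

Lemma npoly_conv a b : eqX (npoly (conv a b)) (npoly a * npoly b).
Proof.
apply/eqXP => i li; rewrite coef_npoly // coefM /conv natr_sum.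
apply: eq_bigr => j _; have lj : (j <= i)%N by rewrite -ltnS.
by rewrite natrM !coef_npoly //; lia.
Qed.

Definition sparse3 (s : nat -> nat) (n : nat) : nat :=
  if (3 %| n)%N then s (n %/ 3)%N else 0%N.

Lemma npoly_sparse3 s : eqX (npoly (sparse3 s)) (npoly s \Po 'X^3).
Proof.
apply/eqXP => i li; rewrite coef_npoly // coef_comp_poly_Xn // /sparse3.
by case: ifP => // _; rewrite coef_npoly //; lia.
Qed.

Lemma eqX_comp3 p q : eqX p q -> eqX (p \Po 'X^3) (q \Po 'X^3).
Proof. by rewrite (_ : 'X^3 = 'X * 'X^2) ?exprS //; apply: eqX_comp. Qed.

End CongrX.

(** The series of [skew_sum] is h(w c(w)): writing h(x) = h(0) + x g(x), with g the shifted series,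
    matches [skew_sumS]. The induction lowers [N] along with [m], so the two truncation orders are
    kept apart. *)
Lemma comp_skew_sum m h N M : (m < N)%N -> (m <= M)%N ->
  (npoly N h \Po ('X * npoly M catalan))`_m = (skew_sum m h)%:R.
Proof.
have [k] := ubnP m; elim: k m h N => // k IH m h [//|N] lmk lmN lmM.
have -> : npoly N.+1 h = (h 0%N)%:R%:P + 'X * npoly N (fun r => h r.+1).
  apply/polyP => i; rewrite coef_poly coefD coefC coefXM coef_poly.
  by case: i => [|i] /=; rewrite ?addr0 ?add0r.
rewrite comp_polyD comp_polyC comp_polyM comp_polyX coefD coefC -mulrA coefXM.
case: m lmk lmN lmM => [|m] lmk lmN lmM /=; first by rewrite addr0 skew_sum0.
rewrite add0r coefMr skew_sumS natr_sum; apply: eq_bigr => q _.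
have lqm : (q <= m)%N by rewrite -ltnS.
by rewrite natrM coef_npoly ?IH //; lia.
Qed.

Lemma npoly_skew_sum N h :
  eqX N (npoly N (skew_sum^~ h)) (npoly N h \Po ('X * npoly N catalan)).
Proof.
by apply/eqXP => i li; rewrite coef_npoly // comp_skew_sum // ltnW.
Qed.

(** The [f] marks cut a bridge into [f + 1] unmarked ones, each counted by central binomials. *)
Lemma npoly_bridges N f :
  eqX N (npoly N (fun r => bridges f r r)) (npoly N central_bin ^+ f.+1).
Proof.
elim: f => [|f IH].
  by apply/eqXP => i li; rewrite expr1 !coef_npoly //= addnn.
rewrite exprSr; apply: eqX_trans (eqXM IH (eqX_refl _ _)).
apply: eqX_trans (npoly_conv _ _ _); apply/eqXP => i li.
rewrite !coef_npoly // bridgesS /conv; congr _%:R.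
by apply: eq_bigr => j _; rewrite mulnC.
Qed.

Lemma npoly_central_bin N :
  eqX N (npoly N central_bin ^+ 2 * (1 - 4 * 'X)) 1.
Proof.
have h : eqX N (npoly N central_bin ^+ 2) (npoly N (expn 4)).
  apply: eqX_sym; rewrite expr2; apply: eqX_trans (npoly_conv _ _ _).
  by apply/eqXP => i li; rewrite !coef_npoly // conv_central_bin.
apply: eqX_trans (eqXM h (eqX_refl _ _)) _; apply/eqXP => i li.
rewrite mulrBr mulr1 coefB mulr_natl mulrnAr coefMn coefMX coef1 coef_npoly //.
case: i li => [|i] li /=; first by rewrite mul0rn subr0.
by rewrite coef_npoly ?expnS ?mulr_natl ?natrM ?mulr_natl ?subrr // ltnW.
Qed.

(** The coefficients of B = 1 / sqrt (1 - 4 w c(w)), which counts words without fixed points. *)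
Definition bridge_skew (m : nat) : nat := skew_sum m central_bin.

Lemma npoly_bridge_skew N :
  eqX N (npoly N bridge_skew ^+ 2 * (1 - 4 * ('X * npoly N catalan))) 1.
Proof.
have := eqX_comp (npoly N catalan) (npoly_central_bin N).
rewrite comp_polyM rmorphXn /= comp_polyB comp_polyM comp_polyX comp_polyC.
rewrite rmorph_nat.
apply: eqX_trans; apply: eqXM (eqX_refl _ _); apply: eqX_exp.
exact: npoly_skew_sum.
Qed.

Lemma npoly_skew_bridges N f :
  eqX N (npoly N (skew_sum^~ (fun r => bridges f r r))) (npoly N bridge_skew ^+ f.+1).
Proof.
apply: eqX_trans (npoly_skew_sum _ _) _.
apply: eqX_trans (eqX_comp _ (npoly_bridges N f)) _.
by rewrite rmorphXn /=; apply: eqX_exp; apply: eqX_sym; apply: npoly_skew_sum.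
Qed.

Lemma catalanS m : catalan m.+1 = conv catalan catalan m.
Proof.
rewrite catalanE skew_sumS /conv (reindex_inj rev_ord_inj) /=; apply: eq_bigr => i _.
by rewrite -catalanE subSS subKn // -ltnS.
Qed.

Lemma npoly_catalan N : eqX N (npoly N catalan) (1 + 'X * npoly N catalan ^+ 2).
Proof.
apply: eqX_trans (eqXD (eqX_refl _ _) (eqXM (eqX_refl _ _) _)); last first.
  by rewrite expr2; apply: npoly_conv.
apply/eqXP => i li; rewrite coefD coef1 coefXM coef_npoly //.
case: i li => [|i] li /=; first by rewrite addr0 catalanE skew_sum0.
by rewrite add0r coef_npoly -?catalanS // ltnW.
Qed.

(** * Recurrences for the series in z *)

Definition cat3 := sparse3 catalan.
Definition bskew3 := sparse3 bridge_skew.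

Lemma cat3_rec n : cat3 n.+3 = conv cat3 cat3 n.
Proof.
pose N := n.+4.
have h := eqX_comp3 (npoly_catalan N).
rewrite comp_polyD comp_polyC comp_polyM comp_polyX rmorphXn /= in h.
have {}h : eqX N (npoly N cat3) (1 + 'X^3 * npoly N (conv cat3 cat3)).
  apply: eqX_trans (npoly_sparse3 _ _) _; apply: eqX_trans h _.
  apply: eqXD (eqX_refl _ _) (eqXM (eqX_refl _ _) _); apply: eqX_sym.
  apply: eqX_trans (npoly_conv _ _ _) _; rewrite expr2.
  by apply: eqXM; apply: npoly_sparse3.
move/eqXP/(_ n.+3 (leqnn _)): h; rewrite coefD coef1 add0r coefXnM coef_npoly //.
rewrite /= (_ : (n.+3 - 3)%N = n) ?coef_npoly; try lia.
Qed.

Lemma bskew3_rec n :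
  conv bskew3 bskew3 n.+3 = (4 * conv cat3 (conv bskew3 bskew3) n)%N.
Proof.
pose N := n.+4.
have h := eqX_comp3 (npoly_bridge_skew N).
rewrite comp_polyM rmorphXn /= comp_polyB comp_polyM comp_polyM comp_polyX comp_polyC in h.
rewrite rmorph_nat in h.
have hB : eqX N (npoly N (conv bskew3 bskew3)) ((npoly N bridge_skew \Po 'X^3) ^+ 2).
  apply: eqX_trans (npoly_conv _ _ _) _; rewrite expr2.
  by apply: eqXM; apply: npoly_sparse3.
have {}h : eqX N (npoly N (conv bskew3 bskew3))
    (1 + 4%:R *: ('X^3 * npoly N (conv cat3 (conv bskew3 bskew3)))).
  apply: (eqX_trans hB).
  set B := _ \Po _ in h *; set C := _ \Po _ in h.
  (* The first summand is congruent to 1 by [npoly_bridge_skew]. *)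
  have -> : B ^+ 2 = B ^+ 2 * (1 - 4 * ('X^3 * C)) + 4 * 'X^3 * (C * B ^+ 2) by ring.
  rewrite -mul_polyC polyC_natr; apply: eqXD => //; rewrite mulrA; apply: eqXM.
    exact: eqX_refl.
  apply: eqX_sym; apply: eqX_trans (npoly_conv _ _ _) _; apply: (eqXM _ hB).
  exact: npoly_sparse3.
move/eqXP/(_ n.+3 (leqnn _)): h; rewrite coefD coef1 add0r coefZ coefXnM coef_npoly //.
rewrite /= (_ : (n.+3 - 3)%N = n) ?coef_npoly; try lia.
Qed.

Local Close Scope ring_scope.

Lemma sum_multiples3 n (G : nat -> nat) :
  \sum_(k < n.+1 | 3 %| k) G k = \sum_(m < n.+1 | 3 * m <= n) G (3 * m).
Proof.
rewrite (reindex_onto (fun m : 'I_n.+1 => inord (3 * m))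
                      (fun k : 'I_n.+1 => inord (k %/ 3))) /=; last first.
  move=> k hk; apply: ord_inj; have := ltn_ord k.
  move=> lk; have lk3 : k %/ 3 < n.+1 := leq_ltn_trans (leq_div _ _) lk.
  by rewrite (inordK lk3) mulnC divnK // inordK.
have in_le (m : 'I_n.+1) : 3 * m <= n -> (inord (3 * m) : 'I_n.+1) = 3 * m :> nat.
  by move=> h; rewrite inordK.
rewrite (eq_bigl (fun m : 'I_n.+1 => 3 * m <= n)); last first.
  move=> m; have [h|h] := leqP (3 * m) n.
    rewrite in_le // dvdn_mulr //=; apply/eqP/ord_inj.
    by rewrite mulKn // inord_val.
  (* When [3 * m > n], [inord] falls back to 0, whose quotient by 3 is not [m]; such [m] drop out of
     the reindexed sum. *)
  have -> : inord (3 * m) = ord0 :> 'I_n.+1.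
    by rewrite /inord /insubd insubF //; apply/negbTE; rewrite -leqNgt.
  rewrite /= div0n; apply/negbTE/eqP => /(congr1 val) /=.
  by rewrite inordK // => e; rewrite -e in h.
by apply: eq_bigr => m h; rewrite in_le.
Qed.

Local Open Scope ring_scope.

(** Here [f] is the number of fixed points, and only [f < N] matters modulo ['X^N]. *)
Lemma npoly_code_count N :
  eqX N (npoly N code_count)
    (\sum_(f < N) 'X^f * (npoly N bridge_skew \Po 'X^3) ^+ f.+1).
Proof.
pose Q f := npoly N (sparse3 (skew_sum^~ (fun r => bridges f r r))).
apply: (@eqX_trans _ (\sum_(f < N) 'X^f * Q f)); last first.
  apply: eqX_sum => f; apply: eqXM (eqX_refl _ _) _.
  apply: eqX_trans (npoly_sparse3 _ _) _.
  by rewrite -rmorphXn; apply/eqX_comp3/npoly_skew_bridges.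
apply/eqXP => n ln; rewrite coef_npoly // coef_sum.
pose F f : int := (sparse3 (skew_sum^~ (fun r => bridges f r r)) (n - f))%:R.
transitivity (\sum_(f < n.+1) F f); last first.
  rewrite (big_ord_widen N F ln) big_mkcond /=; apply: eq_bigr => f _.
  rewrite coefXnM ltnS leqNgt; case: ltnP => // lfn.
  by rewrite coef_npoly //; lia.
have -> : code_count n = \sum_(k < n.+1 | (3 %| k)%N)
    skew_sum (k %/ 3) (fun r => bridges (n - k) r r).
  rewrite (sum_multiples3 n (fun k => skew_sum (k %/ 3) (fun r => bridges (n - k) r r))).
  by apply: eq_bigr => m _; rewrite mulKn.
rewrite (reindex_inj rev_ord_inj) /= natr_sum big_mkcond /=; apply: eq_bigr => k _.
rewrite subSS /F subKn; last by rewrite -ltnS.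
by rewrite /sparse3; case: ifP.
Qed.

Lemma npoly_code_count_rec N :
  eqX N (npoly N code_count) (npoly N bskew3 + 'X * npoly N (conv bskew3 code_count)).
Proof.
set B := npoly N bridge_skew \Po 'X^3.
have hB : eqX N (npoly N bskew3) B by apply: npoly_sparse3.
have hA := npoly_code_count N; rewrite -/B in hA.
set S := \sum_(f < N) _ in hA.
(* [S] is a truncated geometric series of ratio ['X * B]; its remainder is a multiple of ['X^N]. *)
have hS : S = B + 'X * (B * S) - B ^+ N.+1 * 'X^N.
  have := subrX1 ('X * B) N; rewrite exprMn.
  have -> : S = B * \sum_(i < N) ('X * B) ^+ i.
    by rewrite big_distrr /=; apply: eq_bigr => f _; rewrite exprMn exprS; ring.
  move=> e; rewrite exprS.
  set T := \sum_(i < N) _ in e *.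
  have e' : 'X^N * B ^+ N = ('X * B - 1) * T + 1 by rewrite -e; ring.
  by rewrite -[B * B ^+ N * _]mulrA [B ^+ N * _]mulrC e'; ring.
apply: (eqX_trans hA); apply: (@eqX_trans _ (B + 'X * (B * S))).
  by exists (- B ^+ N.+1); rewrite {1}hS; ring.
apply: eqX_sym; apply: eqXD => //; apply: eqXM (eqX_refl _ _) _.
by apply: eqX_trans (npoly_conv _ _ _) _; apply: eqXM.
Qed.

Lemma code_count0 : code_count 0 = bskew3 0.
Proof.
have /eqXP/(_ 0%N isT) := npoly_code_count_rec 1.
by rewrite coefD coefXM addr0 !coef_npoly //; lia.
Qed.

Lemma code_countS n :
  code_count n.+1 = (bskew3 n.+1 + conv bskew3 code_count n)%N.
Proof.
have /eqXP/(_ n.+1 (ltnSn _)) := npoly_code_count_rec n.+2.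
by rewrite coefD coefXM /= !coef_npoly //; lia.
Qed.

(** * Geometric growth bounds *)

Lemma horner_le_coef (p q : {poly rat}) x : 0 <= x ->
  (forall i, p`_i <= q`_i) -> p.[x] <= q.[x].
Proof.
move=> x0 h; pose M := maxn (size p) (size q).
rewrite !(@horner_coef_wide _ M) ?leq_maxl ?leq_maxr //.
by apply: ler_sum => i _; rewrite ler_wpM2r ?exprn_ge0.
Qed.

Definition catalan_poly N : {poly rat} := \poly_(i < N) (catalan i)%:R.

(* 2 is the fixed point of y |-> 1 + y ^ 2 / 4, which dominates the passage from
   one partial sum at 1/4 to the next. *)
Lemma catalan_poly_le2 N : (catalan_poly N).[1 / 4%:R] <= 2%:R.
Proof.
elim: N => [|N IH]; first by rewrite /catalan_poly poly_def big_ord0 horner0.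
set x := 1 / _ in IH *; have x0 : 0 <= x by rewrite /x; lra.
have cge i : 0 <= (catalan_poly N)`_i by rewrite coef_poly; case: ifP; rewrite ?ler0n.
have : (catalan_poly N.+1).[x] <= (1 + 'X * catalan_poly N ^+ 2).[x].
  apply: horner_le_coef => // i; rewrite coefD coef1 coefXM coef_poly expr2.
  case: i => [|i] /=; first by rewrite catalanE skew_sum0 addr0.
  rewrite add0r ltnS coefM; case: ltnP => li; last first.
    by apply: sumr_ge0 => j _; rewrite mulr_ge0.
  rewrite catalanS /conv natr_sum; apply: ler_sum => j _; rewrite natrM.
  have lj : (j <= i)%N by rewrite -ltnS.
  by rewrite !coef_poly (leq_ltn_trans lj li) (leq_ltn_trans (leq_subr j i) li).
rewrite hornerD hornerC hornerM hornerX horner_exp => /le_trans; apply.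
have : 0 <= (catalan_poly N).[x].
  by rewrite -(horner0 x); apply: horner_le_coef => // i; rewrite coef0.
by move: (_.[x]) IH => y; rewrite /x; nra.
Qed.

(** One term of a partial sum at 1/4 is at most the whole sum, hence at most 2. *)
Lemma catalan_le n : (catalan n <= 2 * 4 ^ n)%N.
Proof.
have h : (catalan n)%:R * (1 / 4%:R) ^+ n <= 2%:R :> rat.
  apply: le_trans (catalan_poly_le2 n.+1).
  rewrite (@horner_coef_wide _ n.+1) ?size_poly // big_ord_recr /= coef_poly ltnSn.
  rewrite lerDr; apply: sumr_ge0 => i _; rewrite coef_poly.
  by apply: mulr_ge0; [case: ifP | apply: exprn_ge0].
rewrite -(ler_nat rat) natrM natrX.
rewrite expr_div_n expr1n mulrA mulr1 ler_pdivrMr ?exprn_gt0 // in h.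
Qed.

Local Close Scope ring_scope.

Lemma cat3_le n : cat3 n <= 2 * 4 ^ n.
Proof.
rewrite /cat3 /sparse3; case: ifP => // _; apply: leq_trans (catalan_le _) _.
by rewrite leq_mul2l leq_exp2l // leq_div.
Qed.

(** When one rate is twice the other, convolving costs only a factor 2, by the geometric sum of
    powers of 2. *)
Lemma geom_conv_le K n : \sum_(i < n.+1) K ^ i * (2 * K) ^ (n - i) <= 2 * (2 * K) ^ n.
Proof.
have h : \sum_(i < n.+1) K ^ i * (2 * K) ^ (n - i) = K ^ n * \sum_(i < n.+1) 2 ^ (n - i).
  rewrite big_distrr /=; apply: eq_bigr => i _; rewrite expnMn mulnCA -expnD.
  by rewrite subnKC ?leq_ord 1?mulnC.
rewrite h expnMn mulnA [_ * K ^ n]mulnC leq_mul2l; apply/orP; right.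
rewrite (reindex_inj rev_ord_inj) /=; 
under eq_bigr => i _ do rewrite subSS (subKn (leq_ord i)).
elim: n {h} => [|n IH]; first by rewrite big_ord1.
by rewrite big_ord_recr /= expnS; lia.
Qed.

Lemma cat3_0 : cat3 0 = 1.
Proof. by rewrite /cat3 /sparse3 /= catalanE skew_sum0. Qed.

Lemma bskew3_0 : bskew3 0 = 1.
Proof. by rewrite /bskew3 /sparse3 /= /bridge_skew skew_sum0. Qed.

Lemma conv_bskew3_small n : n < 3 -> conv bskew3 bskew3 n = (n == 0).
Proof.
by case: n => [|[|[|//]]] _; rewrite /conv !big_ord_recr big_ord0 /= bskew3_0.
Qed.

(** The recurrence costs a factor 4 * 2 * 2 = 16, while the shift by three indices leaves room for 8
    ^ 3. *)
Lemma conv_bskew3_le n : conv bskew3 bskew3 n <= 8 ^ n.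
Proof.
have [k] := ubnP n; elim: k n => // k IH n lnk.
have [ln|ln] := ltnP n 3.
  by rewrite conv_bskew3_small //; case: n {lnk ln} => // n; rewrite expn_gt0.
have -> : n = (n - 3).+3 by lia.
rewrite bskew3_rec {1}/conv; set p := n - 3.
have : \sum_(i < p.+1) cat3 i * conv bskew3 bskew3 (p - i) <=
       \sum_(i < p.+1) 2 * (4 ^ i * (2 * 4) ^ (p - i)).
  apply: leq_sum => i _; rewrite mulnA leq_mul ?cat3_le // IH //.
  by rewrite /p; lia.
rewrite -big_distrr /= => h; have := geom_conv_le 4 p; move: h.
set S := \sum_(i < _) 4 ^ _ * _; set T := \sum_(i < _) _; rewrite !expnS.
move: (8 ^ p) => e; change (2 * 4) with 8; lia.
Qed.

(** As [bskew3 0 = 1], the number itself is one term of its self-convolution. *)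
Lemma bskew3_le n : bskew3 n <= 8 ^ n.
Proof.
apply: leq_trans (conv_bskew3_le n).
by rewrite /conv big_ord_recl bskew3_0 mul1n subn0 leq_addr.
Qed.

(** The two terms of the recurrence are at most 8 and 2 times 16 ^ n, within the 16 times
    available. *)
Lemma code_count_le n : code_count n <= 16 ^ n.
Proof.
have [k] := ubnP n; elim: k n => // k IH [|n] lnk.
  by rewrite code_count0 bskew3_0.
rewrite code_countS; have h1 := bskew3_le n.+1.
have h2 : conv bskew3 code_count n <= \sum_(i < n.+1) 8 ^ i * (2 * 8) ^ (n - i).
  by apply: leq_sum => i _; rewrite leq_mul ?bskew3_le // IH //; lia.
have h3 := geom_conv_le 8 n; have h4 : 8 ^ n <= 16 ^ n.
  by have [->|n0] := posnP n; rewrite ?expn0 ?leq_exp2r.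
rewrite expnS in h1; rewrite expnS; change (2 * 8) with 16 in h2, h3.
by lia.
Qed.

Open Scope R_scope.

Theorem theorem4p9 :
  exists eps : R, 0 < eps /\
    forall z : R, Rabs z < eps ->
      infinite_sum (fun n => INR (a13 n) * z ^ n)
        (/ (1 - z) * Ftx (2 / (1 - z)) (catC (z ^ 3) - 1)) /\
      infinite_sum (fun n => INR (a13 n) * z ^ n)
        (catC (z ^ 3) /
           (sqrt (catC (z ^ 3) * (4 - 3 * catC (z ^ 3))) - z * catC (z ^ 3))).
Proof.
have bound (s : nat -> nat) M k : (0 < k <= 16)%N ->
    (forall n, s n <= M * expn k n)%N -> geom_bounded s.
  move=> /andP[k0 k16] h; exists M => n; apply: (leq_trans (h n)).
  by rewrite leq_mul2l; apply/orP; right; have [->|n0] := posnP n; rewrite ?expn0 ?leq_exp2r.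
have [||||||||||||||eps eps0 h] := @generating_function cat3 bskew3 code_count.
- by apply: (bound _ 2%N 4%N) => //; exact: cat3_le.
- by apply: (bound _ 1%N 8%N) => // n; rewrite mul1n bskew3_le.
- by apply: (bound _ 1%N 16%N) => // n; rewrite mul1n code_count_le.
- by apply: (bound _ 1%N 8%N) => // n; rewrite mul1n conv_bskew3_le.
- exact: cat3_0.
- by [].
- by [].
- exact: cat3_rec.
- exact: bskew3_0.
- exact: conv_bskew3_small.
- exact: conv_bskew3_small.
- exact: bskew3_rec.
- by rewrite code_count0 bskew3_0.
- exact: code_countS.
exists eps; split=> // z hz; have [h1 h2] := h z hz.
have e l : infinite_sum (fun n => INR (code_count n) * z ^ n) l ->
    infinite_sum (fun n => INR (a13 n) * z ^ n) l.
  move=> hl; apply/is_series_Reals; apply: (is_series_ext _ _ _ _ (proj2 (is_series_Reals _ _) hl)).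
  by move=> n; rewrite a13E.
by split; apply: e.
Qed.
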